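(* For a greedy reading policy, with probability one, $$\limsup_{n\to\infty}\frac{R_{\mathbf G}(n)-n/2}{\sqrt{2\sigma_{R_{\mathbf G}}^2 n\log_2 n}}=1=-\liminf_{n\to\infty}\frac{R_{\mathbf G}(n)-n/2}{\sqrt{2\sigma_{R_{\mathbf G}}^2 n\log_2 n}},\qquad\sigma_{R_{\mathbf G}}^2:=\frac{\sigma_{\mathbf R}^2+\sigma_{\mathbf S}^2}{8\mu^2}.$$
   Context: Let $(r_i)_{i\ge1}$, $(s_i)_{i\ge1}$ be probability vectors on the positive integers with $\mu:=\sum_i r_is_i>0$. Let $\{L_{\mathbf R}(n)\}_{n\ge1}$, $\{L_{\mathbf S}(n)\}_{n\ge1}$ be independent i.i.d. sequences with $\Pr(L_{\mathbf R}(1)=i)=r_i$, $\Pr(L_{\mathbf S}(1)=i)=s_i$. Put $X_{\mathbf R}(n)=s_{L_{\mathbf R}(n)}$, $X_{\mathbf S}(n)=r_{L_{\mathbf S}(n)}$ (common mean $\mu$, variances $\sigma_{\mathbf R}^2,\sigma_{\mathbf S}^2$; standing assumption $\sigma_{\mathbf R}+\sigma_{\mathbf S}>0$), and $\Gamma_{\mathbf R}[m]=\sum_{j=1}^mX_{\mathbf R}(j)$, $\Gamma_{\mathbf S}[m]=\sum_{j=1}^mX_{\mathbf S}(j)$. A reading policy is a $\{0,1\}$-valued process $C(n)$ ($C(n)=1$ iff the $n$-th record is read from $\mathbf R$), $R(n)=\sum_{j\le n}C(j)$, $S(n)=n-R(n)$, with $C(n)$ being $\mathcal F_{n-1}$-measurable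 where $\mathcal F_n=\mathcal F_0\vee\sigma(L_{\mathbf R}(1),\dots,L_{\mathbf R}(R(n));L_{\mathbf S}(1),\dots,L_{\mathbf S}(S(n)))$ and $\mathcal F_0$ (randomization) is independent of the labels. A greedy policy satisfies, for $n\ge1$, $C(n+1)=1$ if $\Gamma_{\mathbf S}[S(n)]>\Gamma_{\mathbf R}[R(n)]$ and $C(n+1)=0$ if $\Gamma_{\mathbf S}[S(n)]<\Gamma_{\mathbf R}[R(n)]$ (ties arbitrary); the subscript $\mathbf G$ refers to it. $\log_2 n=\log\log n$. *)

(* Defs.v *)
From HB Require Import structures.
From mathcomp Require Import all_boot all_order all_algebra.
From mathcomp Require Import all_classical all_reals all_analysis.
Set Implicit Arguments. Unset Strict Implicit. Unset Printing Implicit Defensive.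
Import Order.TTheory GRing.Theory Num.Theory.
Import numFieldNormedType.Exports.
Local Open Scope classical_set_scope.
Local Open Scope ring_scope.

Section Defs.
Context {R : realType}.

(* (p_i)_{i>=1} is a probability vector on the positive integers
   (indexed by nat, with p 0 = 0). *)
Definition prob_vector (p : nat -> R) : Prop :=
  p 0%N = 0 /\ (forall i, 0 <= p i) /\ series p @ \oo --> (1 : R).

Definition mu_rs (r s : nat -> R) : R := limn (series (fun i => r i * s i)).

(* variance of X_R(1) = s_{L_R(1)}:  sum_i r_i (s_i - mu)^2 *)
Definition var_lab (p q : nat -> R) (m : R) : R :=
  limn (series (fun i => p i * (q i - m) ^+ 2)).

Definition Gam {Om : Type} (L : nat -> Om -> nat) (w : nat -> R) (m : nat) (om : Om) : R :=
  \sum_(1 <= j < m.+1) w (L j om).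

End Defs.

Section Proc.
Context {d : measure_display} {T : measurableType d} {R : realType}.

Definition Rcnt (C : nat -> T -> bool) (n : nat) (om : T) : nat :=
  \sum_(1 <= j < n.+1) (C j om : nat).

Definition Scnt (C : nat -> T -> bool) (n : nat) (om : T) : nat :=
  (n - Rcnt C n om)%N.

Definition cyl (LR LS : nat -> T -> nat) (ka kb : seq nat) (va vb : nat -> nat)
  : set T :=
  [set om | (forall k, k \in ka -> LR k om = va k) /\
            (forall k, k \in kb -> LS k om = vb k)].

Definition Gsig (F0 : set (set T)) (LR LS : nat -> T -> nat) (a b : nat)
  : set (set T) :=
  <<s F0 `|` [set A | exists k i, (1 <= k <= a)%N /\ A = [set om | LR k om = i]]
         `|` [set A | exists k i, (1 <= k <= b)%N /\ A = [set om | LS k om = i]] >>.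

(* A is F_n-measurable, where
   F_n = F_0 \/ sigma(L_R(1..R(n)), L_S(1..S(n))) (random indices: stopped
   sigma-algebra):  A /\ {R(n) = a} in G_{a, n-a} for every a <= n. *)
Definition in_Fn (F0 : set (set T)) (LR LS : nat -> T -> nat)
  (C : nat -> T -> bool) (n : nat) (A : set T) : Prop :=
  forall a, (a <= n)%N -> Gsig F0 LR LS a (n - a) (A `&` [set om | Rcnt C n om = a]).

End Proc.

(* Main.v *)
(** By greediness the two matched totals [Gam LR s (R(n))] and [Gam LS r (S(n))]
    never differ by more than one increment.  Subtracting the common drift [mu]
    from the increments, with [A] and [B] the centred walks of the two sources,
    this reads [2 mu (R(n) - n/2) = B(S(n)) - A(R(n)) + O(1)].  Since [A] and [B]
    are [O(sqrt (n ln n))], the indices [R(n)] and [S(n)] are within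
    [O(sqrt (n ln n))] of [n/2], and over such short stretches the walks oscillate
    by [o(sqrt n)] only; hence [2 mu (R(n) - n/2) = (B - A)(n/2) + o(sqrt n)], and
    the claim is the law of the iterated logarithm for the i.i.d. walk [B - A].

    The law of the iterated logarithm for bounded steps rests on the moment
    generating function alone: a maximal Chernoff bound with Borel-Cantelli along
    [(1 + eps)^k] for the upper half, a tilting argument for the lower tail with
    the independent blocks [N^k, N^(k+1)) for the lower half. *)
Require Import Defs.
From HB Require Import structures.
From mathcomp Require Import all_boot all_order all_algebra.
From mathcomp Require Import all_classical all_reals all_analysis.
From mathcomp Require Import ring lra zify.
Import Order.TTheory GRing.Theory Num.Theory.
Import numFieldNormedType.Exports.
Local Open Scope classical_set_scope.
Local Open Scope ring_scope.

(** * Iterated expectations of finite label sequences *)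

(** Since R(n) depends on the labels, A(R(n)) is not a sum of a fixed number of independent steps.
    The estimates on the walks are therefore uniform over all starting indices i <= n, so that
    replacing R(n) and S(n) by n/2 is a pathwise argument on one almost sure event. The k-th labels
    of both sources are read as one pair, which makes B - A a single i.i.d. walk with step variance
    v = sigma_R^2 + sigma_S^2. At time n/2 its variance is v n / 2, and division by (2 mu)^2 gives v
    n / (8 mu^2), the constant of the theorem. Every event to be estimated depends on finitely many
    labels, so its probability is an iterated sum, and exponential moments, tilting and Doob's
    inequality become inequalities between bounded functions of finite sequences. The probability
    measure enters through the law of label prefixes and Borel-Cantelli only. *)

Definition bdd_on {R : realType} {U : Type} (A : U -> Prop) (f : U -> R) :=
  exists M : R, forall x, A x -> `|f x| <= M.

(* Only bounded functions matter: [E] is a series, and [limn] of a divergent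
   series is a junk value. *)
Record mean {R : realType} {K : Type} (E : (K -> R) -> R) : Prop := {
  mean1 : E (fun=> 1) = 1;
  mean_lin : forall (a : R) f g, bdd_on (fun=> True) f ->
    bdd_on (fun=> True) g -> E (fun x => a * f x + g x) = a * E f + E g;
  mean_le : forall f g, bdd_on (fun=> True) f -> bdd_on (fun=> True) g ->
    (forall x, f x <= g x) -> E f <= E g }.

Section Bounded.
Context {R : realType} {U : Type}.
Implicit Types (A : U -> Prop) (f g : U -> R).

Lemma bdd_onD A f g : bdd_on A f -> bdd_on A g -> bdd_on A (fun x => f x + g x).
Proof.
move=> [M hM] [N hN]; exists (M + N) => x Ax.
by rewrite (le_trans (ler_normD _ _))// lerD ?hM ?hN.
Qed.

Lemma bdd_onM A f g : bdd_on A f -> bdd_on A g -> bdd_on A (fun x => f x * g x).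
Proof.
move=> [M hM] [N hN]; exists (M * N) => x Ax.
by rewrite normrM ler_pM ?hM ?hN.
Qed.

Lemma bdd_on_cst A (c : R) : bdd_on A (fun=> c).
Proof. by exists `|c|. Qed.

Lemma bdd_on_itv A f a b : (forall x, A x -> a <= f x <= b) -> bdd_on A f.
Proof.
move=> h; exists (`|a| + `|b|) => x Ax; have /andP[h1 h2] := h _ Ax.
rewrite ler_norml; apply/andP; split.
  by have := ler_norm (- a); rewrite normrN; have := normr_ge0 b; lra.
by have := ler_norm b; have := normr_ge0 a; lra.
Qed.

Lemma bdd_on_bool A (b : U -> bool) : bdd_on A (fun x => (b x)%:R : R).
Proof.
by apply: (@bdd_on_itv _ _ 0 1) => x _; case: (b x); rewrite ?lexx ?ler01.
Qed.

Lemma bdd_on_expR A f : bdd_on A f -> bdd_on A (fun x => expR (f x)).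
Proof.
move=> [M hM]; apply: (@bdd_on_itv _ _ 0 (expR M)) => x Ax.
by rewrite expR_ge0 ler_expR (le_trans (ler_norm _))// hM.
Qed.

End Bounded.

Section Mean.
Context {R : realType} {K : Type} {E : (K -> R) -> R} (HE : mean E).

Let T0 : K -> Prop := fun=> True.

Lemma mean_cst (c : R) : E (fun=> c) = c.
Proof.
have b1 : bdd_on T0 (fun=> 1 : R) by exact: bdd_on_cst.
have := mean_lin _ HE (c - 1) _ _ b1 b1.
rewrite (mean1 _ HE) mulr1 subrK => {2}<-.
by congr E; apply/funext => x; rewrite mulr1 subrK.
Qed.

Lemma meanZ (a : R) f : bdd_on T0 f -> E (fun x => a * f x) = a * E f.
Proof.
move=> bf; have := mean_lin _ HE a _ _ bf (bdd_on_cst T0 0).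
rewrite mean_cst addr0 => <-.
by congr E; apply/funext => x; rewrite addr0.
Qed.

Lemma meanD f g : bdd_on T0 f -> bdd_on T0 g ->
  E (fun x => f x + g x) = E f + E g.
Proof.
move=> bf bg; have := mean_lin _ HE 1 _ _ bf bg; rewrite mul1r => <-.
by congr E; apply/funext => x; rewrite mul1r.
Qed.

Lemma mean_norm f (M : R) : (forall x, `|f x| <= M) -> `|E f| <= M.
Proof.
move=> h; have bf : bdd_on T0 f by exists M.
rewrite ler_norml.
have -> : - M <= E f <= M = (E (fun=> - M) <= E f <= E (fun=> M)) by rewrite !mean_cst.
by apply/andP; split; apply: (mean_le _ HE) => //; try exact: bdd_on_cst;
  move=> x; have := h x; rewrite ler_norml => /andP[].
Qed.

(* [Eseq n f] is the expectation of [f (k_1, ..., k_n)] for independent labels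
   [k_i] of mean [E]; [f] is only evaluated on sequences of size [n]. *)
Fixpoint Eseq (n : nat) (f : seq K -> R) : R :=
  if n is m.+1 then E (fun x => Eseq m (fun l => f (x :: l))) else f [::].

(** Walks are bounded only on sequences of a fixed length, hence boundedness relative to a predicate
    in [bdd_on]. *)
Let Sz n : seq K -> Prop := fun l => size l = n.

Lemma Eseq_norm n f (M : R) : (forall l, size l = n -> `|f l| <= M) ->
  `|Eseq n f| <= M.
Proof.
elim: n f => [|n IH] f h /=; first exact: h.
by apply: mean_norm => x; apply: IH => l hl; apply: h; rewrite /= hl.
Qed.

Lemma bdd_on_Eseq n (f : seq K -> R) : bdd_on (Sz n.+1) f ->
  bdd_on T0 (fun x => Eseq n (fun l => f (x :: l))).
Proof.
by move=> [M hM]; exists M => x _; apply: Eseq_norm => l hl; apply: hM; rewrite /Sz/= hl.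
Qed.

Lemma bdd_on_cons n (f : seq K -> R) x : bdd_on (Sz n.+1) f ->
  bdd_on (Sz n) (fun l => f (x :: l)).
Proof. by move=> [M hM]; exists M => l hl; apply: hM; rewrite /Sz/= hl. Qed.

Lemma Eseq_ext n f g : (forall l, size l = n -> f l = g l) ->
  Eseq n f = Eseq n g.
Proof.
elim: n f g => [|n IH] f g h /=; first exact: h.
by congr E; apply/funext => x; apply: IH => l hl; apply: h; rewrite /= hl.
Qed.

Lemma Eseq_cst n (c : R) : Eseq n (fun=> c) = c.
Proof. by elim: n => //= n ->; exact: mean_cst. Qed.

Lemma Eseq_lin n (a : R) f g : bdd_on (Sz n) f -> bdd_on (Sz n) g ->
  Eseq n (fun l => a * f l + g l) = a * Eseq n f + Eseq n g.
Proof.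
elim: n f g => [//|n IH] f g bf bg /=.
rewrite -(mean_lin _ HE) //; try exact: bdd_on_Eseq.
by congr E; apply/funext => x; rewrite IH //; exact: bdd_on_cons.
Qed.

Lemma EseqZ n (a : R) f : bdd_on (Sz n) f ->
  Eseq n (fun l => a * f l) = a * Eseq n f.
Proof.
move=> bf; have := Eseq_lin n a _ _ bf (bdd_on_cst (Sz n) 0).
rewrite Eseq_cst addr0 => <-.
by apply: Eseq_ext => l _; rewrite addr0.
Qed.

Lemma Eseq_le n f g : bdd_on (Sz n) f -> bdd_on (Sz n) g ->
  (forall l, size l = n -> f l <= g l) -> Eseq n f <= Eseq n g.
Proof.
elim: n f g => [|n IH] f g bf bg h /=; first exact: h.
apply: (mean_le _ HE); try exact: bdd_on_Eseq.
by move=> x; apply: IH; try exact: bdd_on_cons; move=> l hl; apply: h; rewrite /= hl.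
Qed.

Lemma Eseq_cat n m f :
  Eseq (n + m) f = Eseq n (fun l => Eseq m (fun l' => f (l ++ l'))).
Proof.
elim: n f => [//|n IH] f /=.
by congr E; apply/funext => x; rewrite IH.
Qed.

Lemma Eseq_bool_ge0 n (b : seq K -> bool) : 0 <= Eseq n (fun l => (b l)%:R).
Proof.
rewrite -(Eseq_cst n 0); apply: Eseq_le => //; first exact: bdd_on_cst.
exact: bdd_on_bool.
Qed.

Lemma Eseq_bool_le1 n (b : seq K -> bool) : Eseq n (fun l => (b l)%:R) <= 1.
Proof.
rewrite -[leRHS](Eseq_cst n 1); apply: Eseq_le => //; first exact: bdd_on_bool.
  exact: bdd_on_cst.
by move=> l _; case: (b l); rewrite ?ler01.
Qed.

Lemma Eseq_boolC n (b : seq K -> bool) :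
  Eseq n (fun l => (~~ b l)%:R) = 1 - Eseq n (fun l => (b l)%:R).
Proof.
transitivity (-1 * Eseq n (fun l => (b l)%:R) + Eseq n (fun=> 1)); last first.
  by rewrite Eseq_cst mulN1r addrC.
rewrite -Eseq_lin.
- by apply: Eseq_ext => l _; case: (b l); rewrite ?mulr0 ?mulr1 ?add0r ?addNr.
- exact: bdd_on_bool.
- exact: bdd_on_cst.
Qed.

Lemma Eseq_indep n m (f g : seq K -> R) : bdd_on (Sz n) f -> bdd_on (Sz m) g ->
  Eseq (n + m) (fun l => f (take n l) * g (drop n l)) = Eseq n f * Eseq m g.
Proof.
move=> bf bg; rewrite Eseq_cat mulrC -EseqZ//.
apply: Eseq_ext => l hl; rewrite mulrC -EseqZ //; apply: Eseq_ext => l' _.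
by rewrite take_size_cat// drop_size_cat.
Qed.

Lemma Eseq_drop n m (g : seq K -> R) : bdd_on (Sz m) g ->
  Eseq (n + m) (fun l => g (drop n l)) = Eseq m g.
Proof.
move=> bg; rewrite Eseq_cat -(Eseq_cst n (Eseq m g)); apply: Eseq_ext => l hl.
by apply: Eseq_ext => l' _; rewrite drop_size_cat.
Qed.

End Mean.

Arguments Eseq {R K} E n f.

(** * Walks, running maxima and exponential moments *)

Section Walk.
Context {R : realType} {K : Type}.

Definition walk (xi : K -> R) (l : seq K) : R := \sum_(k <- l) xi k.

Lemma walk_cons xi k l : walk xi (k :: l) = xi k + walk xi l.
Proof. by rewrite /walk big_cons. Qed.

Lemma walk_cat xi l l' : walk xi (l ++ l') = walk xi l + walk xi l'.
Proof. by rewrite /walk big_cat. Qed.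

Lemma walkN xi l : walk (fun k => - xi k) l = - walk xi l.
Proof. by rewrite /walk sumrN. Qed.

Lemma walk_norm xi l : (forall k, `|xi k| <= 1) -> `|walk xi l| <= (size l)%:R.
Proof.
move=> h; elim: l => [|k l IH]; first by rewrite /walk big_nil normr0.
rewrite walk_cons (le_trans (ler_normD _ _))//= -[in leRHS]nat1r.
by rewrite lerD.
Qed.

(* Some partial sum of the walk, including the empty one, is at least [a]. *)
Fixpoint reaches (xi : K -> R) (a : R) (l : seq K) : bool :=
  (a <= 0) || (if l is k :: l' then reaches xi (a - xi k) l' else false).

Lemma reachesP xi a l j : a <= walk xi (take j l) -> reaches xi a l.
Proof.
elim: l a j => [|k l IH] a [|j] /=; rewrite ?take0 /walk ?big_nil; try by move=> ->.
rewrite big_cons => h; apply/orP; right; apply: (IH _ j).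
by rewrite /walk lerBlDl.
Qed.

End Walk.

Section MomentGenerating.
Context {R : realType} {K : Type} {E : (K -> R) -> R} (HE : mean E).
Context (xi : K -> R) (xi1 : forall k, `|xi k| <= 1) (Exi : E xi = 0).

Implicit Types lam a b t : R.

Definition mgf (lam : R) : R := E (fun k => expR (lam * xi k)).

Let bxi : bdd_on (fun=> True) xi. Proof. by exists 1. Qed.

Let bexp lam : bdd_on (fun=> True) (fun k => expR (lam * xi k)).
Proof. by apply/bdd_on_expR/bdd_onM => //; exact: bdd_on_cst. Qed.

Lemma bdd_on_expR_walk lam n :
  bdd_on (fun l => size l = n) (fun l => expR (lam * walk xi l)).
Proof.
apply/bdd_on_expR/bdd_onM; first exact: bdd_on_cst.
by exists n%:R => l <-; exact: walk_norm.
Qed.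

(** Jensen's inequality for a centred step, from 1 + x <= expR x. It is the submartingale property
    behind [reaches_le]. *)
Lemma mgf_ge1 lam : 1 <= mgf lam.
Proof.
have -> : 1 = E (fun k => lam * xi k + 1).
  rewrite (mean_lin _ HE)//; last exact: bdd_on_cst.
  by rewrite Exi mulr0 add0r (mean_cst HE).
apply: (mean_le _ HE) => //.
  by apply: bdd_onD; [apply: bdd_onM => //|]; exact: bdd_on_cst.
by move=> k; rewrite addrC expR_ge1Dx.
Qed.

Lemma Eseq_expR_walk lam n :
  Eseq E n (fun l => expR (lam * walk xi l)) = mgf lam ^+ n.
Proof.
elim: n => [|n IH] /=; first by rewrite /walk big_nil mulr0 expR0.
rewrite exprS mulrC -IH -(meanZ HE)//.
congr E; apply/funext => k; rewrite mulrC -(EseqZ HE).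
  by apply: Eseq_ext => l _; rewrite walk_cons mulrDr expRD.
exact: bdd_on_expR_walk.
Qed.

Lemma mgf_ge0 lam : 0 <= mgf lam.
Proof. exact: le_trans ler01 (mgf_ge1 lam). Qed.

(* Doob's inequality for [expR (lam * walk)], by recursion on the first step. *)
Lemma reaches_le lam a n : 0 <= lam ->
  Eseq E n (fun l => (reaches xi a l)%:R) <= expR (- (lam * a)) * mgf lam ^+ n.
Proof.
move=> lam0; elim: n a => [|n IH] a /=.
  rewrite orbF expr0 mulr1; have [a0|_] := leP a 0; last exact: expR_ge0.
  by rewrite -expR0 ler_expR oppr_ge0 mulr_ge0_le0.
have [a0|a0] := leP a 0.
  rewrite (_ : (fun _ => _) = fun=> 1); last first.
    by apply/funext => k; rewrite /= (Eseq_cst HE).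
  rewrite (mean_cst HE) -[leLHS]mulr1 ler_pM// ?exprn_ege1 ?mgf_ge1//.
  by rewrite -expR0 ler_expR oppr_ge0 mulr_ge0_le0.
rewrite exprSr mulrA -(meanZ HE)//.
apply: (mean_le _ HE).
- by apply: (bdd_on_Eseq HE _ (fun l => match l with k :: l' =>
  (reaches xi (a - xi k) l')%:R | _ => 0 end)); exists 1 => -[|k l] _;
    rewrite ?normr0// normr_nat; case: reaches; rewrite ?ler01.
- by apply: bdd_onM => //; exact: bdd_on_cst.
move=> k; apply: (le_trans (IH _)).
rewrite -mulrA [_ * expR _]mulrC mulrA -expRD ler_wpM2r ?exprn_ge0 ?mgf_ge0//.
by rewrite ler_expR; lra.
Qed.

(* Exponential change of measure: on the event that the walk is outside
   [(a, b]], [expR (lam * walk)] is dominated by one of the two exponentials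
   tilted by [(1 -+ t) * lam]. *)
Lemma walk_gt_ge lam t a b n : 0 <= lam -> 0 <= t ->
  expR (- (lam * b)) *
    (mgf lam ^+ n - expR (t * lam * a) * mgf ((1 - t) * lam) ^+ n
     - expR (- (t * lam * b)) * mgf ((1 + t) * lam) ^+ n)
  <= Eseq E n (fun l => (a < walk xi l)%R%:R).
Proof.
move=> lam0 t0.
set e0 := fun l => expR (lam * walk xi l).
set e1 := fun l => expR ((1 - t) * lam * walk xi l).
set e2 := fun l => expR ((1 + t) * lam * walk xi l).
have b0 : bdd_on (fun l => size l = n) e0 by exact: bdd_on_expR_walk.
have b1 : bdd_on (fun l => size l = n) e1 by exact: bdd_on_expR_walk.
have b2 : bdd_on (fun l => size l = n) e2 by exact: bdd_on_expR_walk.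
have bZ c f : bdd_on (fun l => size l = n) f -> bdd_on (fun l : seq K =>
  size l = n) (fun l => c * f l : R).
  by move=> bf; apply: bdd_onM => //; exact: bdd_on_cst.
have bI : bdd_on (fun l : seq K => size l = n) (fun l => (a < walk xi l)%R%:R : R).
  exact: bdd_on_bool.
have -> : expR (- (lam * b)) * (mgf lam ^+ n - expR (t * lam * a) * mgf ((1 - t) * lam) ^+ n
     - expR (- (t * lam * b)) * mgf ((1 + t) * lam) ^+ n) =
   Eseq E n (fun l => expR (- (lam * b)) * (- expR (- (t * lam * b)) * e2 l + (- expR (t
     * lam * a) * e1 l + e0 l))).
  rewrite (EseqZ HE); last by apply: bdd_onD; [exact: bZ|apply: bdd_onD => //; exact: bZ].
  rewrite (Eseq_lin HE)//; last by apply: bdd_onD => //; exact: bZ.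
  by rewrite (Eseq_lin HE)// !Eseq_expR_walk; lra.
apply: (Eseq_le HE) => [|//|l hl].
  by apply/bZ/bdd_onD; [exact: bZ|apply: bdd_onD => //; exact: bZ].
rewrite !mulNr; set w := walk xi l.
have e1E : expR (t * lam * a) * e1 l = e0 l * expR (t * lam * (a - w)).
  by rewrite -!expRD; congr expR; rewrite -/w; lra.
have e2E : expR (- (t * lam * b)) * e2 l = e0 l * expR (t * lam * (w - b)).
  by rewrite -!expRD; congr expR; rewrite -/w; lra.
rewrite e1E e2E.
have e00 : 0 <= e0 l by exact: expR_ge0.
have P1 := expR_ge0 (t * lam * (a - w)).
have P2 := expR_ge0 (t * lam * (w - b)).
(* For w <= a the first tilted exponential exceeds [e0 l], for w > b the second does, and the left
   side is then at most 0. In between, expR (lam (w - b)) <= 1. *)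
have [aw|wa] := ltP a w => /=; last first.
  rewrite -oppr_ge0 -mulrN mulr_ge0 ?expR_ge0//.
  have : 1 <= expR (t * lam * (a - w)) by rewrite -expR0 ler_expR mulr_ge0 ?mulr_ge0
    ?subr_ge0.
  by nra.
have [wb|bw] := leP w b.
  apply: (@le_trans _ _ (expR (- (lam * b)) * e0 l)).
    by rewrite ler_wpM2l ?expR_ge0//; nra.
  by rewrite -expRD -expR0 ler_expR -/w addrC subr_le0 ler_wpM2l.
apply: (@le_trans _ _ 0) => //.
rewrite -oppr_ge0 -mulrN mulr_ge0 ?expR_ge0//.
have : 1 <= expR (t * lam * (w - b)) by rewrite -expR0 ler_expR mulr_ge0 ?mulr_ge0
  ?subr_ge0 ?(ltW bw).
by nra.
Qed.

End MomentGenerating.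

(** * Exponential estimates and the first Borel-Cantelli lemma *)

Section ExpEstimates.
Context {R : realType}.
Implicit Types x y z c : R.

(** The perturbed Taylor polynomial divided by the exponential. Its derivative x^2 (3 c - 1/2 - c x)
    expR (- x) has the sign of c on [-1, 1] for c = 1 and c = -1. *)
Let G c : R -> R :=
  horner (1 + 'X + 2^-1 *: 'X^2 + c *: 'X^3) * (expR \o -%R).

Let GE c x : G c x = (1 + x + x ^+ 2 / 2 + c * x ^+ 3) * expR (- x).
Proof.
rewrite /G [LHS]/GRing.mul/= !hornerE/=; congr (_ * _); lra.
Qed.

Let is_derive_G c x :
  is_derive x 1 (G c) (x ^+ 2 * (3 * c - 1 / 2 - c * x) * expR (- x)).
Proof.
apply: is_derive_eq.
rewrite !derivD !derivZ !derivXn derivX derivC !hornerE /GRing.scale/=.  lra.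
Qed.

Let G_le c x y : (forall z, -1 <= z <= 1 -> 0 <= 3 * c - 1 / 2 - c * z) ->
  -1 <= x -> x <= y -> y <= 1 -> G c x <= G c y.
Proof.
move=> h; apply: ger0_derive1_ndecr.
- by move=> z _; have [] := is_derive_G c z.
- move=> z; rewrite in_itv/= => /andP[/ltW z1 /ltW z2].
  rewrite derive1E (@derive_val _ _ _ _ _ _ _ (is_derive_G c z)).
  apply: mulr_ge0; last exact: expR_ge0.
  by apply: mulr_ge0; [exact: sqr_ge0|apply: h; rewrite z1].
- apply: continuous_subspaceT => z.
  by apply/differentiable_continuous/derivable1_diffP; have [] := is_derive_G c z.
Qed.

Let G_ge c x y : (forall z, -1 <= z <= 1 -> 3 * c - 1 / 2 - c * z <= 0) ->
  -1 <= x -> x <= y -> y <= 1 -> G c y <= G c x.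
Proof.
move=> h; apply: ler0_derive1_nincr.
- by move=> z _; have [] := is_derive_G c z.
- move=> z; rewrite in_itv/= => /andP[/ltW z1 /ltW z2].
  rewrite derive1E (@derive_val _ _ _ _ _ _ _ (is_derive_G c z)).
  apply: mulr_le0_ge0; last exact: expR_ge0.
  by apply: mulr_ge0_le0; [exact: sqr_ge0|apply: h; rewrite z1].
- apply: continuous_subspaceT => z.
  by apply/differentiable_continuous/derivable1_diffP; have [] := is_derive_G c z.
Qed.

(** [G 1] increases and [G (-1)] decreases on [-1, 1], and both equal 1 at 0. For negative x the
    cubic term changes sign, so c = 1 and c = -1 exchange their roles. *)
Lemma expR_taylor2 x : `|x| <= 1 ->
  1 + x + x ^+ 2 / 2 - `|x| * x ^+ 2 <= expR x <= 1 + x + x ^+ 2 / 2 + `|x| * x ^+ 2.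
Proof.
move=> x1.
have eqle (a b : R) : a = b -> a <= b by move=> ->.
have G0 c : G c 0 = 1 by rewrite GE oppr0 expR0; ring.
have div p : p = p * expR (- x) * expR x by rewrite -mulrA -expRD addNr expR0 mulr1.
have le1 p : 1 <= p * expR (- x) -> expR x <= p.
  by move=> h; rewrite (div p) -[leLHS]mul1r ler_wpM2r ?expR_ge0.
have ge1 p : p * expR (- x) <= 1 -> p <= expR x.
  by move=> h; rewrite (div p) -[leRHS]mul1r ler_wpM2r ?expR_ge0.
have h1 z : -1 <= z <= 1 -> 0 <= 3 * 1 - 1 / 2 - 1 * z by move=> /andP[]; lra.
have h2 z : -1 <= z <= 1 -> 3 * -1 - 1 / 2 - -1 * z <= 0 by move=> /andP[]; lra.
move: x1; have [x0|/ltW x0] := leP 0 x => x1.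
- rewrite ger0_norm// in x1 *; apply/andP; split.
  + apply: ge1; rewrite -[leRHS](G0 (-1)); have := @G_ge (-1) 0 x h2.
    rewrite [G _ x]GE => /(_ ltac:(lra) x0 x1); apply: le_trans.
    by apply: eqle; congr (_ * _); lra.
  + apply: le1; rewrite -[leLHS](G0 1); have := @G_le 1 0 x h1.
    rewrite [G _ x]GE => /(_ ltac:(lra) x0 x1) /le_trans; apply.
    by apply: eqle; congr (_ * _); lra.
- rewrite ler0_norm// in x1 *.
  have x1' : -1 <= x by lra.
  have o1 : (0 : R) <= 1 by [].
  apply/andP; split.
  + apply: ge1; rewrite -[leRHS](G0 1); have := @G_le 1 x 0 h1 x1' x0 o1.
    rewrite [G _ x]GE; apply: le_trans.
    by apply: eqle; congr (_ * _); lra.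
  + apply: le1; rewrite -[leLHS](G0 (-1)); have := @G_ge (-1) x 0 h2 x1' x0 o1.
    rewrite [G _ x]GE => /le_trans; apply.
    by apply: eqle; congr (_ * _); lra.
Qed.

(** Inverting (1 + z)^-1 = 1 - z / (1 + z) <= expR (- z / (1 + z)) gives the bound at z / (1 + z),
    which is at least z (1 - z). It turns the Taylor lower bound 1 + z for [mgf] into an
    exponential. *)
Lemma expR_sub_sqr_le z : 0 <= z -> expR (z * (1 - z)) <= 1 + z.
Proof.
move=> z0; have z1 : 0 < 1 + z by lra.
have h : (1 + z)^-1 <= expR (- (z / (1 + z))).
  by apply: le_trans (expR_ge1Dx _); rewrite le_eqVlt; apply/orP; left; apply/eqP; field;
    lra.
rewrite expRN lef_pV2 ?posrE ?expR_gt0// in h.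
apply: le_trans h; rewrite ler_expR ler_pdivlMr//.
have : 0 <= z * z ^+ 2 by rewrite mulr_ge0 ?sqr_ge0.
by lra.
Qed.

Lemma ln_succ_bounds (n : nat) : (0 < n)%N ->
  (n.+1%:R)^-1 <= ln n.+1%:R - ln n%:R :> R /\ ln n.+1%:R - ln n%:R <= n%:R^-1 :> R.
Proof.
move=> n0; have n0' : 0 < n%:R :> R by rewrite ltr0n.
have n1' : 0 < n.+1%:R :> R by rewrite ltr0n.
have e : n.+1%:R = n%:R + 1 :> R by rewrite -natr1.
split.
- rewrite -opprB -ln_div ?posrE// lerNr.
  have -> : n%:R / n.+1%:R = 1 + (- n.+1%:R^-1) :> R.
    by rewrite e; field; rewrite -e lt0r_neq0.
  apply: le_ln1Dx; rewrite ltrN2 invf_lt1// e; lra.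
- rewrite -ln_div ?posrE//.
  have -> : n.+1%:R / n%:R = 1 + n%:R^-1 :> R.
    by rewrite e; field; rewrite lt0r_neq0.
  by apply: le_ln1Dx; rewrite (lt_trans (ltrN10 _))// invr_gt0.
Qed.

(* Telescoping against [- expR (- dl * ln n) / dl], an antiderivative of the summand. *)
Lemma sum_powR_le (dl : R) (n : nat) : 0 < dl ->
  \sum_(i < n) expR (- ((1 + dl) * ln i.+1%:R)) <= 1 + dl^-1.
Proof.
move=> dl0; have di0 : 0 < dl^-1 by rewrite invr_gt0.
have [->|n0] := posnP n; first by rewrite big_ord0; lra.
suff : \sum_(i < n) expR (- ((1 + dl) * ln i.+1%:R)) <= 1 + dl^-1 - dl^-1 * expR (- (dl *
  ln n%:R)).
  by have := mulr_ge0 (ltW di0) (expR_ge0 (- (dl * ln n%:R))); lra.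
case: n n0 => // n _; elim: n => [|n IH].
  by rewrite big_ord1 ln1 !mulr0 oppr0 expR0; lra.
rewrite big_ord_recr/=; apply: (le_trans (lerD IH (lexx _))).
set a := ln n.+2%:R; set b := ln n.+1%:R.
have [h _] := ln_succ_bounds n.+1 (ltn0Sn _); rewrite -/a -/b in h.
have ea : expR (- a) = n.+2%:R^-1 by rewrite expRN lnK// posrE ltr0n.
have -> : expR (- ((1 + dl) * a)) = n.+2%:R^-1 * expR (- (dl * a)).
  by rewrite -ea -expRD; congr expR; lra.
have -> : expR (- (dl * b)) = expR (dl * (a - b)) * expR (- (dl * a)).
  by rewrite -expRD; congr expR; lra.
have := expR_ge1Dx (dl * (a - b)); set u := expR (dl * (a - b)).
have := expR_gt0 (- (dl * a)); set q := expR _ => q0 hu.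
suff : n.+2%:R^-1 <= dl^-1 * (u - 1).
  move: dl^-1 n.+2%:R^-1 => di w /(ler_wpM2r (ltW q0)). lra.
by rewrite ler_pdivlMl// lerBrDl (le_trans _ hu)// lerD2l ler_pM2l.
Qed.

End ExpEstimates.

Lemma borel_cantelli_ae {d} {T : measurableType d} {R : realType} (P : probability T R)
    (F : (set T)^nat) (a : nat -> R) (M : R) :
  (forall n, measurable (F n)) -> (forall n, 0 <= a n) ->
  (forall n, \sum_(i < n) a i <= M) ->
  (\forall n \near \oo, (P (F n) <= (a n)%:E)%E) ->
  {ae P, forall om, \forall n \near \oo, ~ F n om}.
Proof.
move=> mF a0 aM [N _ hN].
(* The shift makes the eventual probability bound hold at every index. *)
pose F' n := F (n + N)%N.
have mF' n : measurable (F' n) by exact: mF.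
have h : P (lim_sup_set F') = 0.
  apply: lim_sup_set_cvg0 => //.
  apply: (@le_lt_trans _ _ M%:E); last exact: ltry.
  apply: lime_le; first exact: is_cvg_nneseries.
  apply: nearW => n.
  apply: (@le_trans _ _ (\sum_(i < n + N) a i)%:E); last by rewrite lee_fin.
  rewrite big_mkord -sumEFin addnC big_split_ord/=.
  rewrite (le_trans _ (leeDr _ _))//; last by apply: sume_ge0 => i _; rewrite lee_fin.
  by apply: lee_sum => i _; rewrite /F' addnC; apply: hN; rewrite /= leq_addr.
exists (lim_sup_set F'); split => //.
  by apply: bigcap_measurable => // n _; apply: bigcup_measurable.
move=> om /= hom n _ /=; apply: contrapT => hn; apply: hom.
exists (n + N)%N => // k /= hk Fk; apply: hn.
exists (k - N)%N => /=; first by lia.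
by rewrite /F' subnK//; lia.
Qed.

(** * Gaussian tail bounds for walks with bounded steps *)

Section GaussianTails.
Context {R : realType} {K : Type} {E : (K -> R) -> R} (HE : mean E).
Context (xi : K -> R) (xi1 : forall k, `|xi k| <= 1) (Exi : E xi = 0).

Implicit Types lam dl a : R.

Definition step_var : R := E (fun k => xi k ^+ 2).

Local Notation v := step_var.
Local Notation mgf := (@mgf R K E xi).

Let bxi : bdd_on (fun=> True) xi. Proof. by exists 1. Qed.

Let bxi2 : bdd_on (fun=> True) (fun k => xi k ^+ 2).
Proof. exact: bdd_onM. Qed.

Lemma step_var_itv : 0 <= v <= 1.
Proof.
rewrite -{1}(mean_cst HE 0) -[in X in _ && X](mean_cst HE 1) /v.
apply/andP; split; apply: (mean_le _ HE) => //; try exact: bdd_on_cst.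
  by move=> k; exact: sqr_ge0.
by move=> k; rewrite -real_normK ?num_real// exprn_ile1.
Qed.

Let Equad (c : R) lam : E (fun k => c * xi k ^+ 2 + (lam * xi k + 1)) = 1 + c * v.
Proof.
rewrite (mean_lin _ HE)//; last first.
  by apply: bdd_onD; [apply: bdd_onM => //|]; exact: bdd_on_cst.
rewrite (mean_lin _ HE)//; last exact: bdd_on_cst.
by rewrite Exi (mean_cst HE) mulr0 add0r addrC.
Qed.

Let bquad (c lam : R) : bdd_on (fun=> True) (fun k => c * xi k ^+ 2 + (lam * xi k + 1)).
Proof.
by do 2![apply: bdd_onD; first by apply: bdd_onM => //; exact: bdd_on_cst];
  exact: bdd_on_cst.
Qed.

Let bexp lam : bdd_on (fun=> True) (fun k => expR (lam * xi k)).
Proof. by apply/bdd_on_expR/bdd_onM => //; exact: bdd_on_cst. Qed.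

Let taylor lam k : `|lam| <= 1 ->
  1 + lam * xi k + lam ^+ 2 / 2 * (1 - 2 * `|lam|) * xi k ^+ 2 <= expR (lam * xi k)
  <= 1 + lam * xi k + lam ^+ 2 / 2 * (1 + 2 * `|lam|) * xi k ^+ 2.
Proof.
move=> lam1.
have h : `|lam * xi k| <= `|lam| by rewrite normrM -[leRHS]mulr1 ler_wpM2l.
have /andP[h1 h2] := expR_taylor2 _ (le_trans h lam1).
have h3 : `|lam * xi k| * (lam * xi k) ^+ 2 <= `|lam| * (lam * xi k) ^+ 2.
  by rewrite ler_wpM2r ?sqr_ge0.
by rewrite !exprMn in h1 h2 h3 *; apply/andP; split; lra.
Qed.

Lemma mgf_le lam : `|lam| <= 1 -> mgf lam <= expR (lam ^+ 2 * v / 2 * (1 + 2 * `|lam|)).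
Proof.
move=> lam1; apply: le_trans (expR_ge1Dx _).
suff : mgf lam <= 1 + lam ^+ 2 / 2 * (1 + 2 * `|lam|) * v by lra.
rewrite -(Equad _ lam); apply: (mean_le _ HE) => // k.
by have /andP[_] := taylor lam k lam1; lra.
Qed.

Lemma mgf_ge lam : `|lam| <= 1 / 2 -> expR (lam ^+ 2 * v / 2 * (1 - 3 * `|lam|)) <= mgf lam.
Proof.
move=> lam1; have lam0 := normr_ge0 lam.
have /andP[v0 v1] := step_var_itv.
set z := lam ^+ 2 / 2 * (1 - 2 * `|lam|) * v.
have l20 := sqr_ge0 lam.
have l2 : 0 <= lam ^+ 2 <= `|lam|.
  by rewrite sqr_ge0/= -real_normK ?num_real// -[leRHS]mul1r expr2 ler_wpM2r//; lra.
have z0 : 0 <= z.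
  by apply: mulr_ge0 => //; apply: mulr_ge0; lra.
have zle : z <= `|lam|.
  rewrite /z; have : (lam ^+ 2 / 2 * (1 - 2 * `|lam|)) * v <= `|lam| * 1.
    by apply: ler_pM => //; [|]; nra.
  lra.
apply: (@le_trans _ _ (1 + z)); last first.
  rewrite -(Equad _ lam); apply: (mean_le _ HE) => // k.
  by have /andP[] := taylor lam k ltac:(lra); lra.
apply: le_trans (expR_sub_sqr_le z z0); rewrite ler_expR.
(* Since z <= |lam|, the factor (1 - 2 |lam|) (1 - z) is at least 1 - 3 |lam|. *)
have -> : lam ^+ 2 * v / 2 * (1 - 3 * `|lam|) = (lam ^+ 2 / 2 * v) * (1 - 3 * `|lam|) by
  lra.
have -> : z * (1 - z) = (lam ^+ 2 / 2 * v) * ((1 - 2 * `|lam|) * (1 - z)) by rewrite /z;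
  ring.
apply: ler_wpM2l; first by apply: mulr_ge0 => //; lra.
nra.
Qed.

Lemma reaches_gauss lam a n : 0 <= lam <= 1 ->
  Eseq E n (fun l => (reaches xi a l)%:R) <=
  expR (n%:R * (lam ^+ 2 * v / 2 * (1 + 2 * lam)) - lam * a).
Proof.
move=> /andP[lam0 lam1]; apply: (le_trans (reaches_le HE xi xi1 Exi lam a n lam0)).
rewrite [leRHS]expRD mulrC ler_wpM2r ?expR_ge0// expRM_natl.
apply: lerXn2r; rewrite ?nnegrE ?expR_ge0 ?(mgf_ge0 HE xi xi1 Exi)//.
by have := mgf_le lam; rewrite ger0_norm// => ->.
Qed.

(** The walk tilted by [lam] has mean about lam v n; the window of [walk_gt_ge] is 1 - dl to 1 + dl
    times that, with t = dl. To second order each subtracted term is smaller than the main one by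
    the factor expR (- dl^2 y / 2), where y = lam^2 v n. Half of this exponent absorbs the errors in
    [mgf]; the other half makes each term at most a quarter of the main one, which leaves 1/2. *)
Lemma walk_gt_gauss dl lam n : 0 < dl <= 1 / 4 -> 0 < lam -> 24 * lam * (1 + dl) <= dl ^+
  2 ->
  expR (- (dl ^+ 2 / 4 * (lam ^+ 2 * v * n%:R))) <= 1 / 4 ->
  expR (- (lam ^+ 2 * v * n%:R / 2 * (1 + 3 * dl))) / 2 <=
  Eseq E n (fun l => ((1 - dl) * (lam * v * n%:R) < walk xi l)%R%:R).
Proof.
move=> /andP[dl0 dl1] lam0 hlam; set y := lam ^+ 2 * v * n%:R => hy.
have /andP[v0 v1] := step_var_itv.
have y0 : 0 <= y by rewrite /y mulr_ge0// mulr_ge0// sqr_ge0.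
set eta := 3 * lam * (1 + dl).
have eta0 : 0 <= eta by rewrite /eta !mulr_ge0//; lra.
have etadl : eta <= dl ^+ 2 / 8 by rewrite /eta; lra.
have dl2 : dl ^+ 2 <= dl / 4 by rewrite expr2; nra.
have lameta : 3 * lam <= eta by rewrite /eta; nra.
apply: le_trans (walk_gt_ge HE xi xi1 lam dl ((1 - dl) * (lam * v * n%:R)) ((1 + dl) *
  (lam * v * n%:R)) n (ltW lam0) (ltW dl0)).
have M0 : expR (y / 2 * (1 - eta)) <= mgf lam ^+ n.
  apply: (@le_trans _ _ (expR (lam ^+ 2 * v / 2 * (1 - 3 * `|lam|)) ^+ n)).
    rewrite -expRM_natl ler_expR gtr0_norm// /y.
    have : 0 <= y / 2 * (eta - 3 * lam) by rewrite mulr_ge0//; lra.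
    rewrite /y.
    lra.
  apply: lerXn2r; rewrite ?nnegrE ?expR_ge0 ?(mgf_ge0 HE xi xi1 Exi)//.
  by apply: mgf_ge; rewrite gtr0_norm//; nra.
have up s : 0 <= s <= 1 + dl -> mgf (s * lam) ^+ n <= expR (s ^+ 2 * (y / 2) * (1 + eta)).
  move=> /andP[s0 s1].
  have sl : 0 <= s * lam by rewrite mulr_ge0// ltW.
  have sl2 : 2 * (s * lam) <= eta.
    have : s * lam <= (1 + dl) * lam by rewrite ler_wpM2r// ltW.
    rewrite /eta; nra.
  have -> : s ^+ 2 * (y / 2) * (1 + eta) = n%:R * ((s * lam) ^+ 2 * v / 2 * (1 + eta)).
    by rewrite /y; lra.
  rewrite expRM_natl; apply: lerXn2r; rewrite ?nnegrE ?expR_ge0 ?(mgf_ge0 HE xi xi1 Exi)//.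
  apply: le_trans (mgf_le _ _) _; first by rewrite ger0_norm//; lra.
  rewrite ler_expR ger0_norm// ler_wpM2l//; last by lra.
  by rewrite mulr_ge0// mulr_ge0// sqr_ge0.
have M1 : expR (dl * lam * ((1 - dl) * (lam * v * n%:R))) * mgf ((1 - dl) * lam) ^+ n
    <= expR (y / 2 * (1 - eta)) / 4.
  have := up (1 - dl) ltac:(lra) => /(ler_wpM2l (expR_ge0 (dl * lam * ((1 - dl) * (lam *
    v * n%:R))))) /le_trans; apply.
  apply: (@le_trans _ _ (expR (y / 2 * (1 - eta)) * expR (- (dl ^+ 2 / 4 * y))));
    last first.
    by have := ler_wpM2l (expR_ge0 (y / 2 * (1 - eta))) hy; lra.
  rewrite -!expRD ler_expR.
  have -> : dl * lam * ((1 - dl) * (lam * v * n%:R)) = dl * (1 - dl) * y by rewrite /y;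
    ring.
  have : 0 <= y * (dl ^+ 2 / 4 - eta) by rewrite mulr_ge0//; lra.
  have : 0 <= y * eta * (1 - (1 - dl) ^+ 2) by apply: mulr_ge0; [exact: mulr_ge0|nra].
  lra.
have M2 : expR (- (dl * lam * ((1 + dl) * (lam * v * n%:R)))) * mgf ((1 + dl) * lam) ^+ n
    <= expR (y / 2 * (1 - eta)) / 4.
  have := up (1 + dl) ltac:(lra) => /(ler_wpM2l (expR_ge0 (- (dl * lam * ((1 + dl) * (lam
    * v * n%:R)))))) /le_trans; apply.
  apply: (@le_trans _ _ (expR (y / 2 * (1 - eta)) * expR (- (dl ^+ 2 / 4 * y))));
    last first.
    by have := ler_wpM2l (expR_ge0 (y / 2 * (1 - eta))) hy; lra.
  rewrite -!expRD ler_expR.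
  have -> : dl * lam * ((1 + dl) * (lam * v * n%:R)) = dl * (1 + dl) * y by rewrite /y;
    ring.
  have : 0 <= y * (dl ^+ 2 / 4 - 3 / 2 * eta) by rewrite mulr_ge0//; lra.
  have : 0 <= y * eta * (2 - (1 + dl) ^+ 2) by apply: mulr_ge0; [exact: mulr_ge0|nra].
  lra.
apply: (@le_trans _ _ (expR (- (lam * ((1 + dl) * (lam * v * n%:R)))) * (expR (y / 2 * (1
  - eta)) / 2))); last first.
  by rewrite ler_wpM2l ?expR_ge0//; lra.
rewrite mulrA -expRD ler_wpM2r ?invr_ge0// ler_expR.
have -> : lam * ((1 + dl) * (lam * v * n%:R)) = (1 + dl) * y by rewrite /y; ring.
have : 0 <= y * (dl - eta) by rewrite mulr_ge0//; lra.
lra.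
Qed.

End GaussianTails.

Arguments step_var {R K} E xi.

(** * Label sequences and the second Borel-Cantelli lemma *)

Section Labels.
Context {d} {T : measurableType d} {R : realType} (P : probability T R).
Context {K : Type} {E : (K -> R) -> R} (HE : mean E) (L : nat -> T -> K).

Definition seg (n m : nat) (om : T) : seq K := [seq L j om | j <- iota n.+1 m].

(** Arbitrary boolean tests are allowed and measurability is part of the statement, because [K]
    carries no sigma-algebra. *)
Definition iid_labels := forall (n : nat) (h : seq K -> bool),
  measurable [set om | h (seg 0 n om)] /\
  P [set om | h (seg 0 n om)] = (Eseq E n (fun l => (h l)%:R))%:E.

Hypothesis iidL : iid_labels.

Lemma size_seg n m om : size (seg n m om) = m.
Proof. by rewrite size_map size_iota. Qed.

Lemma seg_cat n m m' om : seg n (m + m') om = seg n m om ++ seg (n + m) m' om.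
Proof. by rewrite /seg iotaD map_cat addSn. Qed.

Lemma take_seg n m j om : (j <= m)%N -> take j (seg n m om) = seg n j om.
Proof.
by move=> jm; rewrite -(subnKC jm) seg_cat take_size_cat// size_seg.
Qed.

Lemma drop_seg0 n m om : drop n (seg 0 (n + m) om) = seg n m om.
Proof. by rewrite seg_cat drop_size_cat ?size_seg. Qed.

Lemma measurable_seg n m (b : seq K -> bool) : measurable [set om | b (seg n m om)].
Proof.
have [h _] := iidL (n + m) (fun l => b (drop n l)).
by move: h; congr measurable; apply/seteqP; split => om /=; rewrite drop_seg0.
Qed.

Lemma P_seg n m (b : seq K -> bool) :
  P [set om | b (seg n m om)] = (Eseq E m (fun l => (b l)%:R))%:E.
Proof.
have [_ h] := iidL (n + m) (fun l => b (drop n l)).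
rewrite (Eseq_drop HE n m (fun l => (b l)%:R)) in h; last exact: bdd_on_bool.
by rewrite -h; congr (P _); apply/seteqP; split => om /=; rewrite drop_seg0.
Qed.

Section SecondBorelCantelli.
Variables (n : nat -> nat) (b : nat -> seq K -> bool) (k0 : nat) (kap : R).
Hypothesis n_le : forall k, (n k <= n k.+1)%N.
Hypothesis kap0 : 0 < kap.
Hypothesis b_ge : forall k, (k0 <= k)%N ->
  kap * k.+1%:R^-1 <= Eseq E (n k.+1 - n k) (fun l => (b k l)%:R).

Let ev k om := b k (seg (n k) (n k.+1 - n k) om).

(** The event that blocks K0 to K0 + M - 1 all fail, written as a boolean function of one label
    prefix so that [iid_labels] applies to it. *)
Let none K0 : nat -> seq K -> bool := fix none M l :=
  if M is M'.+1 then
    none M' (take (n (K0 + M')) l) && ~~ b (K0 + M') (drop (n (K0 + M')) l)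
  else true.

Let noneP K0 M om : none K0 M (seg 0 (n (K0 + M)) om) <->
  forall k, (K0 <= k < K0 + M)%N -> ~~ ev k om.
Proof.
elim: M => [|M IH] /=.
  by split=> // _ k; rewrite addn0 => /andP[/leq_ltn_trans h /h]; rewrite ltnn.
rewrite addnS take_seg// -(subnKC (n_le (K0 + M))) drop_seg0.
split=> [/andP[/IH h1 h2] k /andP[k1]|h].
  by rewrite ltnS leq_eqVlt => /orP[/eqP->//|k2]; apply: h1; rewrite k1.
apply/andP; split; last by apply: h; rewrite leq_addr ltnSn.
by apply/IH => k /andP[k1 k2]; apply: h; rewrite k1 ltnS ltnW.
Qed.

(** Blocks are independent and each one contributes a factor 1 - p <= expR (- p) with p >= kap / (k
    + 1); the harmonic sum dominates a telescoping sum of logarithms. *)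
Let none_le K0 M : (k0 <= K0)%N -> Eseq E (n (K0 + M)) (fun l => (none K0 M l)%:R) <=
  expR (- (kap * (ln (K0 + M).+1%:R - ln K0.+1%:R))).
Proof.
move=> hK; elim: M => [|M IH].
  rewrite addn0 subrr mulr0 oppr0 expR0; exact: (Eseq_bool_le1 HE).
rewrite addnS -(subnKC (n_le (K0 + M))).
set m := (n (K0 + M).+1 - n (K0 + M))%N.
under [X in Eseq _ _ X]eq_fun => l do rewrite /= -mulnb natrM.
rewrite (Eseq_indep HE _ _ (fun l => (none K0 M l)%:R) (fun l => (~~ b (K0 + M) l)%:R));
  try exact: bdd_on_bool.
rewrite (_ : - _ = - (kap * (ln (K0 + M).+1%:R - ln K0.+1%:R)) + - (kap * (ln (K0 +
  M).+2%:R - ln (K0 + M).+1%:R))); last lra.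
rewrite expRD ler_pM ?(Eseq_bool_ge0 HE)// (Eseq_boolC HE).
apply: le_trans (expR_ge1Dx _); rewrite lerD2l lerN2.
apply: le_trans (b_ge _ _); last by rewrite (leq_trans hK)// leq_addr.
by rewrite ler_pM2l//; have [] := @ln_succ_bounds R (K0 + M).+1 (ltn0Sn _).
Qed.

Lemma borel_cantelli_blocks :
  {ae P, forall om, forall K0, exists2 k, (K0 <= k)%N & b k (seg (n k) (n k.+1 - n k) om)}.
Proof.
apply: ae_foralln => K1; pose K0 := (K1 + k0)%N.
exists (\bigcap_M [set om | none K0 M (seg 0 (n (K0 + M)) om)]); split.
- by apply: bigcapT_measurable => M; exact: measurable_seg.
- apply/eqP; rewrite eq_le measure_ge0 andbT.
  apply/lee_addgt0Pr => e e0; rewrite add0e.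
  have [M hM] : exists M, expR (- (kap * (ln (K0 + M).+1%:R - ln K0.+1%:R))) <= e.
    (* Solves expR (- kap (ln A - ln (K0 + 1))) = e. *)
    pose A := expR (ln K0.+1%:R - ln e / kap).
    exists (Num.truncn A); rewrite -[leRHS]lnK// ler_expR.
    have hA : ln A <= ln (K0 + Num.truncn A).+1%:R.
      rewrite ler_ln ?posrE ?expR_gt0// ltW// (lt_le_trans (truncnS_gt _))//.
      by rewrite ler_nat ltnS leq_addl.
    rewrite expRK in hA.
    have : kap * (ln K0.+1%:R - ln e / kap) <= kap * ln (K0 + Num.truncn A).+1%:R by
      rewrite ler_pM2l.
    by rewrite mulrBr [kap * (ln e / kap)]mulrC divfK ?lt0r_neq0//; lra.
  apply: (@le_trans _ _ (P [set om | none K0 M (seg 0 (n (K0 + M)) om)])).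
    apply: le_measure; rewrite ?inE; first by apply: bigcapT_measurable => i;
      exact: measurable_seg.
      exact: measurable_seg.
    exact: bigcap_inf.
  by rewrite P_seg lee_fin (le_trans (none_le _ _ _))// leq_addl.
- move=> om /= hom M _ /=; apply/noneP => k /andP[k1 _].
  apply/negP => hk; apply: hom; exists k => //.
  by rewrite (leq_trans _ k1)// leq_addr.
Qed.

End SecondBorelCantelli.

Section Steps.
Context (xi : K -> R) (xi1 : forall k, `|xi k| <= 1) (Exi : E xi = 0).

Definition rwalk (n : nat) (om : T) : R := walk xi (seg 0 n om).

Lemma rwalkD n m om : rwalk (n + m) om = rwalk n om + walk xi (seg n m om).
Proof. by rewrite /rwalk seg_cat walk_cat. Qed.

Lemma rwalkB_lt a n m j om : ~~ reaches xi a (seg n m om) -> (j <= m)%N ->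
  rwalk (n + j) om - rwalk n om < a.
Proof.
move=> h jm; rewrite rwalkD addrAC subrr add0r ltNge; apply: contra h => h.
by apply: (@reachesP _ _ xi a _ j); rewrite take_seg.
Qed.

End Steps.

End Labels.

Arguments iid_labels {d T R} P {K} E L.

(** * The law of the iterated logarithm *)

Definition lil_norm {R : realType} (v x : R) : R := Num.sqrt (2 * v * x * ln (ln x)).

Section LilNorm.
Context {R : realType}.
Implicit Types v x y : R.

Lemma lil_norm_le v x y : 0 <= v -> expR 1 <= x -> x <= y -> lil_norm v x <= lil_norm v y.
Proof.
move=> v0 ex xy; rewrite /lil_norm ler_wsqrtr// -!mulrA.
have x0 : 0 < x := lt_le_trans (expR_gt0 1) ex.
have y0 : 0 < y := lt_le_trans x0 xy.
have lx : 1 <= ln x by rewrite -[leLHS]expRK ler_ln ?posrE ?expR_gt0.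
have lxy : ln x <= ln y by rewrite ler_ln ?posrE.
do 2!(apply: ler_wpM2l => //).
rewrite ler_pM ?ln_ge0 ?(ltW x0)// ler_ln ?posrE//; lra.
Qed.

Lemma sqr_le_expR x : 0 <= x -> x ^+ 2 / 2 <= expR x.
Proof. by move=> x0; have := expR_ge1Dxn 1 x0; rewrite (_ : 2`! = 2)%N//; lra. Qed.

Lemma near_mul_ge (b A : R) : 0 < b -> \forall k \near \oo, A <= k.+1%:R * b.
Proof.
move=> b0; have := nbhs_infty_ger (A / b); apply: filterS => k.
by rewrite ler_pdivrMr// => /le_trans; apply; rewrite ler_pM2r// ler_nat.
Qed.

(** The square root is the optimal tilt at time expR x, whose iterated logarithm is ln x. It tends
    to 0, so the cubic errors in [mgf] become negligible. *)
Lemma sqrt_ln_expR_le (c v : R) : 0 < c -> 0 < v ->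
  exists A : R, 1 <= A /\ forall x, A <= x -> Num.sqrt (2 * ln x / (v * expR x)) <= c.
Proof.
move=> c0 v0; exists (Num.max 1 (4 / (v * c ^+ 2))); split; first by rewrite le_max lexx.
move=> x; rewrite ge_max => /andP[x1 xA].
have x0 : 0 < x by lra.
have vc : 0 < v * c ^+ 2 by rewrite mulr_gt0// exprn_gt0.
rewrite -[leRHS]gtr0_norm// -sqrtr_sqr ler_wsqrtr// ler_pdivrMr ?mulr_gt0 ?expR_gt0//.
rewrite ler_pdivrMr// in xA.
have h1 := sqr_le_expR x (ltW x0).
have h2 := ln_sublinear x0.
have : v * c ^+ 2 * (x ^+ 2 / 2) <= v * c ^+ 2 * expR x by rewrite ler_pM2l.
have : 4 * (x / 2) <= x * (v * c ^+ 2) * (x / 2) by rewrite ler_wpM2r//; lra.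
lra.
Qed.

End LilNorm.

(** * Upper half of the law of the iterated logarithm *)

Section UpperLil.
Context {d} {T : measurableType d} {R : realType} {P : probability T R}.
Context {K : Type} {E : (K -> R) -> R} (HE : mean E) {L : nat -> T -> K}.
Context (iidL : iid_labels P E L).
Context (xi : K -> R) (xi1 : forall k, `|xi k| <= 1) (Exi : E xi = 0).
Local Notation v := (step_var E xi).

(** With t_k = expR x_k and lam^2 v t_k = 2 ln x_k, the Chernoff exponent is at most (1 + eps) ln
    x_k (1 + 2 lam) - 2 (1 + eps) ln x_k; the first 1 + eps comes from the horizon t_(k+1), the
    second from the level. For small lam this is at most - (1 + eps / 2) ln x_k, and x_k is
    proportional to k + 1, so the bounds are summable. *)
Lemma lil_upper (eps : R) : 0 < v -> 0 < eps ->
  {ae P, forall om, \forall n \near \oo, rwalk L xi n om <= (1 + eps) * lil_norm v n%:R}.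
Proof.
move=> v0 e0; pose b := ln (1 + eps).
have b0 : 0 < b by rewrite ln_gt0//; lra.
have expb : expR b = 1 + eps by rewrite lnK// posrE; lra.
pose x k : R := k.+1%:R * b.
pose t k := expR (x k).
have tS k : t k.+1 = (1 + eps) * t k.
  by rewrite -expb /t -expRD; congr expR; rewrite /x -(natr1 k.+1); lra.
pose a k := (1 + eps) * lil_norm v (t k).
pose F k := [set om | reaches xi (a k) (seg L 0 (Num.truncn (t k.+1)) om)].
have xnear (A : R) : \forall k \near \oo, A <= x k by exact: near_mul_ge.
have hF : \forall k \near \oo, (P (F k) <=
    (expR (- ((1 + eps / 2) * ln b)) * expR (- ((1 + eps / 2) * ln k.+1%:R)))%:E)%E.
  (* Chosen so that lam <= c gives 2 (1 + eps) lam <= eps / 2. *)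
  pose c := eps / (4 * (1 + eps)).
  have c0 : 0 < c by rewrite divr_gt0//; lra.
  have cE : c * (4 * (1 + eps)) = eps by rewrite divfK// lt0r_neq0//; lra.
  have [A [A1 hA]] := sqrt_ln_expR_le c v c0 v0.
  apply: filterS (xnear A) => k xA.
  have x0 : 0 < x k by lra.
  have l0 : 0 <= ln (x k) by rewrite ln_ge0//; lra.
  have t0 : 0 < t k := expR_gt0 _.
  rewrite (P_seg _ HE _ iidL) lee_fin.
  set lam := Num.sqrt (2 * ln (x k) / (v * t k)).
  have lam0 : 0 <= lam := sqrtr_ge0 _.
  have lamc : lam <= c := hA _ xA.
  have lam1 : lam <= 1 by nra.
  have lam2 : lam ^+ 2 * (v * t k) = 2 * ln (x k).
    rewrite sqr_sqrtr; first by rewrite divfK// lt0r_neq0// mulr_gt0.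
    by rewrite divr_ge0 ?mulr_ge0// ltW// mulr_gt0.
  have lama : lam * a k = (1 + eps) * (2 * ln (x k)).
    rewrite /a mulrCA; congr (_ * _); rewrite /lil_norm /t expRK -sqrtrM; last first.
      by rewrite divr_ge0 ?mulr_ge0// ltW// mulr_gt0.
    rewrite -/(t k) (_ : 2 * v * t k * ln (x k) = v * t k * (2 * ln (x k))); last ring.
    by rewrite (mulrA _ (v * t k)) divfK ?lt0r_neq0 ?mulr_gt0// -expr2 sqrtr_sqr
      ger0_norm// mulr_ge0.
  apply: (le_trans (reaches_gauss HE xi xi1 Exi lam _ _ _)); first by rewrite lam0 lam1.
  rewrite -expRD ler_expR lama.
  have -> : - ((1 + eps / 2) * ln b) - (1 + eps / 2) * ln k.+1%:R = - ((1 + eps / 2) * ln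
    (x k)).
    by rewrite /x lnM ?posrE ?ltr0n//; lra.
  have hN : (Num.truncn (t k.+1))%:R <= (1 + eps) * t k.
    by rewrite -tS truncn_le ?expR_ge0.
  have : (Num.truncn (t k.+1))%:R * (lam ^+ 2 * v / 2 * (1 + 2 * lam)) <=
      (1 + eps) * t k * (lam ^+ 2 * v / 2 * (1 + 2 * lam)).
    apply: ler_wpM2r => //; apply: mulr_ge0; last lra.
    by rewrite divr_ge0// mulr_ge0 ?sqr_ge0 ?ltW.
  have -> : (1 + eps) * t k * (lam ^+ 2 * v / 2 * (1 + 2 * lam)) =
      (1 + eps) * ln (x k) * (1 + 2 * lam).
    have -> : (1 + eps) * t k * (lam ^+ 2 * v / 2 * (1 + 2 * lam)) =
      (1 + eps) / 2 * (1 + 2 * lam) * (lam ^+ 2 * (v * t k)) by lra.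
    by rewrite lam2; lra.
  have : ln (x k) * ((1 + eps) * (2 * lam)) <= ln (x k) * (eps / 2).
    by apply: ler_wpM2l => //; nra.
  lra.
have := borel_cantelli_ae P F _ _ (fun k => measurable_seg _ _ iidL _ _ _) _ _ hF.
move=> /(_ (expR (- ((1 + eps / 2) * ln b)) * (1 + (eps / 2)^-1))) hBC.
apply: filterS (hBC _ _) => [om [k0 _ hk0]|k|n].
- have [k1 _ hk1] := xnear 1.
  have := nbhs_infty_ger (t (k0 + k1)%N); apply: filterS => n hn.
  have n0 : 0 < n%:R :> R by apply: lt_le_trans hn; exact: expR_gt0.
  have hln : x (k0 + k1)%N <= ln n%:R by rewrite -[leLHS]expRK ler_ln ?posrE ?expR_gt0.
  pose q := Num.truncn (ln n%:R / b).
  have lnb0 : 0 <= ln n%:R / b.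
    by rewrite divr_ge0 ?(ltW b0)// (le_trans _ hln)// mulr_ge0 ?ler0n ?ltW.
  have /andP[q1 q2] := truncn_itv lnb0; rewrite -/q in q1 q2.
  have hq : (k0 + k1 < q)%N by rewrite /q truncn_ge_nat// ler_pdivlMr.
  (* As [x k] carries the factor k + 1, the predecessor is the index with t q <= n < t q.+1. *)
  case: q hq q1 q2 => // q; rewrite ltnS => hq q1 q2.
  rewrite ler_pdivlMr// in q1; rewrite ltr_pdivrMr// in q2.
  have tq : t q <= n%:R by rewrite -[leRHS]lnK ?posrE// ler_expR.
  have tq2 : n%:R < t q.+1 by rewrite -[ltLHS]lnK ?posrE// ltr_expR.
  have /negP hr := hk0 q (leq_trans (leq_addr _ _) hq).
  move: (rwalkB_lt L xi (a q) 0 _ n om hr);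
    rewrite add0n {2}/rwalk /walk /seg big_nil subr0.
  move=> /(_ ltac:(by rewrite truncn_ge_nat ?expR_ge0// ltW)) /ltW /le_trans; apply.
  rewrite ler_wpM2l//; first lra.
  by apply: lil_norm_le; rewrite ?(ltW v0)// ler_expR;
    exact: hk1 (leq_trans (leq_addl _ _) hq).
- by rewrite mulr_ge0 ?expR_ge0.
- by rewrite -mulr_sumr ler_wpM2l ?expR_ge0// sum_powR_le//; lra.
Qed.

End UpperLil.

(** Used at y = ln n, where it says that (ln n)^3 = o(n). *)
Lemma cube_le_expR {R : realType} (c : R) : 0 < c ->
  exists A : R, 1 <= A /\ forall y, A <= y -> y ^+ 3 <= c * expR y.
Proof.
move=> c0; exists (Num.max 1 (24 / c)); split; first by rewrite le_max lexx.
move=> y; rewrite ge_max => /andP[y1 yA].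
rewrite ler_pdivrMr// in yA.
have y0 : 0 <= y by lra.
have := expR_ge1Dxn 3 y0; rewrite (_ : 4`! = 24)%N// => h.
have : y ^+ 3 * 24 <= y ^+ 3 * (y * c) by rewrite ler_wpM2l// exprn_ge0.
have : c * (1 + y ^+ 4 / 24) <= c * expR y by rewrite ler_pM2l.
have -> : y ^+ 4 = y ^+ 3 * y by rewrite exprSr.
lra.
Qed.

Section Negation.
Context {R : realType} {K : Type} {E : (K -> R) -> R} (HE : mean E).
Context (xi : K -> R) (xi1 : forall k, `|xi k| <= 1) (Exi : E xi = 0).

Lemma step_varN : step_var E (fun k => - xi k) = step_var E xi.
Proof. by congr E; apply/funext => k; rewrite sqrrN. Qed.

Lemma mean_stepN : E (fun k => - xi k) = 0.
Proof.
have -> : (fun k => - xi k) = (fun k => -1 * xi k) by apply/funext => k; rewrite mulN1r.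
by rewrite (meanZ HE) ?Exi ?mulr0//; exists 1.
Qed.

Lemma step_normN k : `|- xi k| <= 1. Proof. by rewrite normrN. Qed.

End Negation.

(** * Bounds on increments, uniform in the starting index *)

Section Oscillation.
Context {d} {T : measurableType d} {R : realType} {P : probability T R}.
Context {K : Type} {E : (K -> R) -> R} (HE : mean E) {L : nat -> T -> K}.
Context (iidL : iid_labels P E L).

Lemma rwalkN xi n om : rwalk L (fun k => - xi k : R) n om = - rwalk L xi n om.
Proof. by rewrite /rwalk walkN. Qed.

(** A union bound over n + 1 starting indices, each of probability at most (n + 1)^-3, leaves the
    summable (n + 1)^-2. The 3 in 3 / 2 bounds v (1 + 2 lam), as v and lam are at most 1. *)
Lemma increments_lt (xi : K -> R) (H : nat -> nat) (lam a : nat -> R) :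
  (forall k, `|xi k| <= 1) -> E xi = 0 ->
  (\forall n \near \oo, 0 <= lam n <= 1 /\
     (H n)%:R * (lam n ^+ 2 * 3 / 2) - lam n * a n <= - (3 * ln n.+1%:R)) ->
  {ae P, forall om, \forall n \near \oo, forall i h, (i <= n)%N -> (h <= H n)%N ->
     rwalk L xi (i + h) om - rwalk L xi i om < a n}.
Proof.
move=> xi1 Exi hlam.
pose F n := \big[setU/set0]_(i < n.+1) [set om | reaches xi (a n) (seg L i (H n) om)].
have mF n : measurable (F n).
  by apply: bigsetU_measurable => i _; exact: measurable_seg iidL _ _ _.
have := borel_cantelli_ae P F (fun n => expR (- ((1 + 1) * ln n.+1%:R))) (1 + 1^-1) mF.
move=> /(_ (fun n => expR_ge0 _) (fun n => sum_powR_le 1 n ltr01)) hBC.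
apply: filterS (hBC _) => [om|].
  apply: filterS => n hn i h hi hh; apply: rwalkB_lt hh.
  apply/negP => hr; apply: hn; rewrite /F -(bigcup_mkord n.+1 (fun i =>
    [set om | reaches xi (a n) (seg L i (H n) om)])).
  by exists i.
apply: filterS hlam => n [lam01 hn].
have := Boole_inequality P (n := n.+1) (fun i _ =>
  measurable_seg _ _ iidL i (H n) (reaches xi (a n))).
move=> /le_trans; apply.
apply: (@le_trans _ _ (\sum_(i < n.+1) (expR (- (3 * ln n.+1%:R)))%:E)%E).
  apply: lee_sum => i _.
  rewrite [leLHS](P_seg P HE L iidL i (H n) (reaches xi (a n))) lee_fin.
  apply: (le_trans (reaches_gauss HE xi xi1 Exi (lam n) _ _ lam01)).
  rewrite ler_expR; apply: le_trans hn; rewrite lerD2r ler_wpM2l//.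
  have /andP[v0 v1] := step_var_itv HE xi xi1.
  have /andP[l0 l1] := lam01.
  have h : lam n ^+ 2 * (step_var E xi * (1 + 2 * lam n)) <= lam n ^+ 2 * 3.
    by rewrite ler_wpM2l ?sqr_ge0//; nra.
  lra.
rewrite sumEFin lee_fin sumr_const card_ord -[leLHS]mulr_natl -[X in X * _ <= _]lnK
  ?posrE ?ltr0n//.
by rewrite -expRD ler_expR; lra.
Qed.

Lemma increments_norm_lt (xi : K -> R) (H : nat -> nat) (lam a : nat -> R) :
  (forall k, `|xi k| <= 1) -> E xi = 0 ->
  (\forall n \near \oo, 0 <= lam n <= 1 /\
     (H n)%:R * (lam n ^+ 2 * 3 / 2) - lam n * a n <= - (3 * ln n.+1%:R)) ->
  {ae P, forall om, \forall n \near \oo, forall i h, (i <= n)%N -> (h <= H n)%N ->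
     `|rwalk L xi (i + h) om - rwalk L xi i om| < a n}.
Proof.
move=> xi1 Exi hlam.
have h1 := increments_lt xi H lam a xi1 Exi hlam.
have h2 := increments_lt _ H lam a (step_normN xi xi1) (mean_stepN HE xi xi1 Exi) hlam.
apply: filterS2 h1 h2 => om; apply: filterS2 => n g1 g2 i h hi hh.
have := g1 _ _ hi hh; have := g2 _ _ hi hh; rewrite !rwalkN.
by rewrite ltr_norml => p1 p2; apply/andP; split; lra.
Qed.

Lemma walk_rough_bound (xi : K -> R) : (forall k, `|xi k| <= 1) -> E xi = 0 ->
  {ae P, forall om, \forall n \near \oo, forall m, (m <= n)%N ->
     `|rwalk L xi m om| < 6 * Num.sqrt (n.+1%:R * ln n.+1%:R)}.
Proof.
move=> xi1 Exi.
(* This tilt makes the exponent at most (3/2 - 6) ln (n + 1), below the required - 3 ln (n + 1).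
   Only the starting index 0 is used afterwards. *)
have := increments_norm_lt xi id (fun n => Num.sqrt (ln n.+1%:R / n.+1%:R))
  (fun n => 6 * Num.sqrt (n.+1%:R * ln n.+1%:R)) xi1 Exi.
move=> h; apply: filterS (h _) => [om|].
  apply: filterS => n /(_ 0%N) hn m mn.
  by have := hn m (leq0n _) mn; rewrite add0n [X in _ - X]/rwalk /walk /seg big_nil subr0.
apply: nearW => n.
have n0 : 0 < n.+1%:R :> R by rewrite ltr0n.
have l0 : 0 <= ln n.+1%:R :> R by rewrite ln_ge0// ler1n.
split.
  rewrite sqrtr_ge0/= -[leRHS]sqrtr1 ler_wsqrtr// ler_pdivrMr// mul1r.
  exact/ltW/ln_sublinear.
rewrite sqr_sqrtr ?divr_ge0 ?(ltW n0)//.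
have e : Num.sqrt (ln n.+1%:R / n.+1%:R) * Num.sqrt (n.+1%:R * ln n.+1%:R) = ln n.+1%:R
  :> R.
  rewrite -sqrtrM ?divr_ge0 ?(ltW n0)// mulrA divfK ?lt0r_neq0//.
  by rewrite -expr2 sqrtr_sqr ger0_norm.
rewrite [Num.sqrt _ * (6 * _)]mulrCA e.
suff : n%:R * (ln n.+1%:R / n.+1%:R) <= ln n.+1%:R :> R.
  by rewrite /=; move: (ln n.+1%:R / n.+1%:R) => w; lra.
rewrite mulrCA ler_piMr// ler_pdivrMr// mul1r ler_nat//.
Qed.

(** The tilt is chosen so that lam a = 5 ln n. Over a stretch of length C sqrt (n ln n) the
    quadratic term is of order (ln n)^(5/2) / sqrt n, eventually below 2 ln n, and 2 - 5 = - 3. *)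
Lemma walk_oscillation (xi : K -> R) (C eps : R) : (forall k, `|xi k| <= 1) -> E xi = 0 ->
  0 < C -> 0 < eps ->
  {ae P, forall om, \forall n \near \oo, forall i h, (i <= n)%N ->
     h%:R <= C * Num.sqrt (n.+1%:R * ln n.+1%:R) ->
     `|rwalk L xi (i + h) om - rwalk L xi i om| < eps * Num.sqrt n.+1%:R}.
Proof.
move=> xi1 Exi C0 e0.
have := increments_norm_lt xi (fun n => Num.truncn (C * Num.sqrt (n.+1%:R * ln n.+1%:R)))
  (fun n => 5 * ln n.+1%:R / (eps * Num.sqrt n.+1%:R)) (fun n =>
    eps * Num.sqrt n.+1%:R) xi1 Exi.
move=> h; apply: filterS (h _) => [om|].
  apply: filterS => n hn i k ik kC; apply: hn => //.
  by rewrite truncn_ge_nat// mulr_ge0 ?sqrtr_ge0// ltW.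
have e20 : 0 < eps ^+ 2 by rewrite exprn_gt0.
(* With y = ln (n + 1) and z = n + 1, the quadratic term is at most 2 y once sqrt (z y) y <= q z,
   that is y^3 <= q^2 z. *)
have [q qC q0] : exists2 q, q * (75 / 2 * C) = eps ^+ 2 * 2 & 0 < q.
  exists (eps ^+ 2 * 2 / (75 / 2 * C)).
    by rewrite divfK// lt0r_neq0// mulr_gt0//; lra.
  by rewrite divr_gt0//; [lra|rewrite mulr_gt0//; lra].
(* [c1] serves lam <= 1, [c2] the quadratic term. *)
pose c1 := eps ^+ 2 / 25; pose c2 := q ^+ 2.
have c10 : 0 < c1 by rewrite divr_gt0.
have c20 : 0 < c2 by rewrite exprn_gt0.
have [A1 [A11 hA1]] := cube_le_expR c1 c10.
have [A2 [A21 hA2]] := cube_le_expR c2 c20.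
have := nbhs_infty_ger (expR (A1 + A2)); apply: filterS => n hn /=.
have n0 : 0 < n.+1%:R :> R by rewrite ltr0n.
have hy : A1 + A2 <= ln n.+1%:R.
  rewrite -[leLHS]expRK ler_ln ?posrE ?expR_gt0// (le_trans hn)// ler_nat//.
have en : expR (ln n.+1%:R) = n.+1%:R :> R by rewrite lnK ?posrE.
have := hA1 (ln n.+1%:R) ltac:(lra); have := hA2 (ln n.+1%:R) ltac:(lra); rewrite en.
have y1 : 1 <= ln n.+1%:R :> R by lra.
move: (ln n.+1%:R) y1 => y y1.
move: (n.+1%:R : R) n0 => z z0 hz2 hz1 {h hn hy en}.
have sz0 : 0 < Num.sqrt z by rewrite sqrtr_gt0.
have sz2 : Num.sqrt z ^+ 2 = z by rewrite sqr_sqrtr// ltW.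
have lamE : 5 * y / (eps * Num.sqrt z) * (eps * Num.sqrt z) = 5 * y.
  by rewrite divfK// lt0r_neq0// mulr_gt0.
set lam := 5 * y / (eps * Num.sqrt z) in lamE *.
have lam0 : 0 <= lam by rewrite divr_ge0 ?mulr_ge0//; lra.
have y23 : y ^+ 2 <= y ^+ 3 by rewrite ler_weXn2l.
split.
  rewrite lam0/= ler_pdivrMr ?mulr_gt0// mul1r -ler_sqr ?nnegrE ?mulr_ge0 ?(ltW e0) ?(ltW
    sz0)//; try lra.
  rewrite !exprMn sz2; rewrite /c1 in hz1; lra.
rewrite lamE.
have hs : Num.sqrt (z * y) * y <= q * z.
  rewrite -ler_sqr ?nnegrE ?mulr_ge0 ?sqrtr_ge0 ?(ltW q0) ?(ltW z0)//; try lra.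
  rewrite !exprMn sqr_sqrtr; last by rewrite mulr_ge0//; lra.
  have : z * y ^+ 3 <= z * (c2 * z) by rewrite ler_wpM2l// ltW.
  rewrite /c2 => hh; apply: le_trans (_ : z * y ^+ 3 <= _); first by rewrite exprS; lra.
  apply: (le_trans hh); lra.
have lam2 : lam ^+ 2 * (eps ^+ 2 * z) = 25 * y ^+ 2.
  by rewrite -{1}sz2 -exprMn -exprMn lamE; ring.
suff : (Num.truncn (C * Num.sqrt (z * y)))%:R * (lam ^+ 2 * 3 / 2) <= 2 * y by lra.
apply: (@le_trans _ _ (C * Num.sqrt (z * y) * (lam ^+ 2 * 3 / 2))).
  rewrite ler_wpM2r//; first by rewrite divr_ge0// mulr_ge0// sqr_ge0.
  by rewrite truncn_le mulr_ge0 ?sqrtr_ge0// ltW.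
rewrite -(ler_pM2r (mulr_gt0 e20 z0)).
have -> : C * Num.sqrt (z * y) * (lam ^+ 2 * 3 / 2) * (eps ^+ 2 * z) =
  (75 / 2 * C) * (Num.sqrt (z * y) * y) * y.
  have -> : C * Num.sqrt (z * y) * (lam ^+ 2 * 3 / 2) * (eps ^+ 2 * z) =
    C * Num.sqrt (z * y) * 3 / 2 * (lam ^+ 2 * (eps ^+ 2 * z)) by lra.
  by rewrite lam2; lra.
have -> : 2 * y * (eps ^+ 2 * z) = (75 / 2 * C) * (q * z) * y.
  have -> : (75 / 2 * C) * (q * z) * y = q * (75 / 2 * C) * z * y by lra.
  by rewrite qC; lra.
by rewrite ler_wpM2r ?ler_wpM2l//; rewrite ?mulr_ge0//; lra.
Qed.

End Oscillation.

(** * Lower half of the law of the iterated logarithm *)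

Section LowerLil.
Context {d} {T : measurableType d} {R : realType} {P : probability T R}.
Context {K : Type} {E : (K -> R) -> R} (HE : mean E) {L : nat -> T -> K}.
Context (iidL : iid_labels P E L).
Context (xi : K -> R) (xi1 : forall k, `|xi k| <= 1) (Exi : E xi = 0).
Local Notation v := (step_var E xi).

Lemma walk_block_gt (dl : R) (N : nat) : 0 < v -> 0 < dl <= 1 / 8 -> (2 <= N)%N ->
  exists k0 : nat, forall k, (k0 <= k)%N ->
    (2 * ln N%:R)^-1 * k.+1%:R^-1 <=
    Eseq E (N ^ k.+1 - N ^ k) (fun l =>
      ((1 - dl) * Num.sqrt (2 * (1 - 4 * dl) * v * (N ^ k.+1 - N ^ k)%:R * ln (ln (N ^
        k.+1)%:R))
       < walk xi l)%R%:R).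
Proof.
move=> v0 /andP[dl0 dl1] N2.
have lnN : 0 < ln N%:R :> R by rewrite ln_gt0// ltr1n.
(* A tilt below [c] satisfies 24 lam (1 + dl) <= dl^2, since 1 + dl <= 2. Below, v / 2 replaces v
   because a block fills at least half of [0, N^(k+1)). *)
pose c := dl ^+ 2 / 48.
have dl20 : 0 < dl ^+ 2 by rewrite exprn_gt0.
have c0 : 0 < c by rewrite divr_gt0.
have v20 : 0 < v / 2 by lra.
have [A [A1 hA]] := sqrt_ln_expR_le c (v / 2) c0 v20.
(* For ln x >= B the last hypothesis of [walk_gt_gauss] holds, as 1 - 4 dl >= 1/2. *)
pose B := 4 * ln 4 / dl ^+ 2 + 1.
have [k0 _ hk0] := near_mul_ge (ln N%:R) (A + expR B) lnN.
exists k0 => k hk; have := hk0 _ hk.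
have N0 : 0 < N%:R :> R by rewrite ltr0n (ltnW N2).
have lnNk : ln (N ^ k.+1)%:R = k.+1%:R * ln N%:R :> R.
  by rewrite natrX lnXn// mulr_natl.
rewrite lnNk; have : expR (k.+1%:R * ln N%:R) = (N ^ k.+1)%:R :> R.
  by rewrite -lnNk lnK// posrE ltr0n expn_gt0 (ltnW N2).
have mE : (N ^ k.+1)%:R / 2 <= (N ^ k.+1 - N ^ k)%:R :> R.
  rewrite ler_pdivrMr// -natrM ler_nat expnS.
  have : (2 * N ^ k <= N * N ^ k)%N by rewrite leq_mul2r N2 orbT.
  by move: (N * N ^ k)%N (N ^ k)%N => a b; clear; lia.
have -> : (2 * ln N%:R)^-1 * k.+1%:R^-1 = (k.+1%:R * ln N%:R)^-1 / 2 :> R.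
  by rewrite -!invfM; congr (_^-1); ring.
set m := (N ^ k.+1 - N ^ k)%N in mE *.
move: (k.+1%:R * ln N%:R) => x ex xAB; rewrite -ex in mE.
have B0 := expR_gt0 B.
have ln4 : 0 < ln 4 :> R by rewrite ln_gt0//; lra.
have xA : A <= x by lra.
have x0 : 0 < x by lra.
have lB : B <= ln x by rewrite -[leLHS]expRK ler_ln ?posrE//; lra.
have B1 : 1 <= B by rewrite lerDr divr_ge0 ?(ltW dl20)// mulr_ge0// ltW.
set l := ln x in lB *.
have l0 : 0 < l by lra.
have m0 : 0 < m%:R :> R by have := expR_gt0 x; lra.
(* The factor 1 - 4 dl compensates the loss 1 + 3 dl of [walk_gt_gauss]: their product is at most 1,
   so the probability is at least expR (- ln x) / 2 = 1 / (2 x), the harmonic rate. *)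
pose lam := Num.sqrt (2 * (1 - 4 * dl) * l / (v * m%:R)).
have num0 : 0 < 2 * (1 - 4 * dl) * l by rewrite mulr_gt0//; lra.
have vm0 : 0 < v * m%:R by rewrite mulr_gt0.
have lam0 : 0 < lam by rewrite sqrtr_gt0 divr_gt0.
have yE : lam ^+ 2 * v * m%:R = 2 * (1 - 4 * dl) * l.
  by rewrite sqr_sqrtr ?divr_ge0 ?ltW// -mulrA divfK// lt0r_neq0.
have lamE : lam * v * m%:R = Num.sqrt (2 * (1 - 4 * dl) * v * m%:R * l).
  rewrite -[LHS]ger0_norm ?mulr_ge0 ?ltW// -sqrtr_sqr; congr Num.sqrt.
  rewrite (_ : (lam * v * m%:R) ^+ 2 = lam ^+ 2 * v * m%:R * (v * m%:R)); last ring.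
  by rewrite yE; ring.
have lamc : lam <= c.
  apply: le_trans (hA _ xA); rewrite ler_wsqrtr// -/l.
  apply: ler_pM; rewrite ?(ltW num0) ?invr_ge0 ?(ltW vm0)//.
    by have : 0 <= dl * l; [rewrite mulr_ge0 ?ltW|lra].
  rewrite lef_pV2 ?posrE ?mulr_gt0 ?expR_gt0//.
  have : v * (expR x / 2) <= v * m%:R by rewrite ler_pM2l.
  lra.
rewrite -lamE.
have h1 : 24 * lam * (1 + dl) <= dl ^+ 2.
  have : lam * (1 + dl) <= c * 2 by apply: ler_pM; rewrite ?(ltW lam0)//; lra.
  by rewrite /c; lra.
have h2 : expR (- (dl ^+ 2 / 4 * (lam ^+ 2 * v * m%:R))) <= 1 / 4.
  rewrite yE -[leRHS]lnK ?posrE// ler_expR div1r lnV ?posrE// lerN2.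
  have : dl ^+ 2 * (4 * ln 4 / dl ^+ 2) <= dl ^+ 2 * l.
    by rewrite ler_pM2l//; move: lB; rewrite /B; lra.
  rewrite mulrC divfK ?lt0r_neq0//.
  have : 0 <= dl ^+ 2 * l * (1 - 8 * dl) by rewrite mulr_ge0// ?mulr_ge0 ?(ltW l0) ?(ltW
    dl20)//; lra.
  lra.
have dl14 : 0 < dl <= 1 / 4 by rewrite dl0/=; lra.
apply: le_trans (walk_gt_gauss HE xi xi1 Exi dl lam m dl14 lam0 h1 h2).
rewrite yE ler_wpM2r// -[in leLHS](lnK (_ : x \in Num.pos)) ?posrE// -expRN ler_expR
  lerN2 -/l.
have : 0 <= l * (dl + 12 * dl ^+ 2) by rewrite mulr_ge0 ?(ltW l0)//; lra.
lra.
Qed.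

Lemma lil_lower (eps : R) : 0 < v -> 0 < eps ->
  {ae P, forall om, forall n0, exists2 n, (n0 <= n)%N &
     (1 - eps) * lil_norm v n%:R <= rwalk L xi n om}.
Proof.
move=> v0 e0.
(* The block increment loses the factor (1 - dl)^2 (1 - 4 dl) >= 1 - 6 dl, and the walk before the
   block costs another 2 dl. *)
pose dl := Num.min (1 / 8) (eps / 8).
have dl0 : 0 < dl by rewrite lt_min; lra.
have dl1 : dl <= 1 / 8 by rewrite ge_min lexx.
have dle : dl <= eps / 8 by rewrite ge_min lexx orbT.
have dl20 : 0 < dl ^+ 2 by rewrite exprn_gt0.
(* With dl^2 N >= 1, the normalization at N^k is at most dl times the one at N^(k+1). *)
pose N := (Num.truncn (dl ^+ 2)^-1).+2.
have N2 : (2 <= N)%N by [].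
have N0 : 0 < N%:R :> R by rewrite ltr0n.
have hN : 1 <= dl ^+ 2 * N%:R.
  rewrite -ler_pdivrMl// mulr1 (le_trans (ltW (truncnS_gt _)))// ler_nat//.
have hdl : 0 < dl <= 1 / 8 by rewrite dl0.
have [k0 hk0] := walk_block_gt dl N v0 hdl N2.
have lnN : 0 < ln N%:R :> R by rewrite ln_gt0// ltr1n.
have nle k : (N ^ k <= N ^ k.+1)%N by rewrite leq_exp2l.
have kap0 : 0 < (2 * ln N%:R)^-1 :> R by rewrite invr_gt0 mulr_gt0.
have := borel_cantelli_blocks P HE L iidL (fun k => N ^ k)%N _ k0 _ nle kap0 hk0.
(* The upper half for the negated walk, with eps = 1, bounds the walk before the block from below by
   -2 times the normalization. *)
have := lil_upper HE iidL _ (step_normN xi xi1) (mean_stepN HE xi xi1 Exi) 1.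
rewrite (step_varN xi) => /(_ v0 ltr01).
apply: filterS2 => om [n1 _ hn1] hblocks n0.
have [k1 _ hk1] := near_mul_ge 1 (expR 1) (ltr01 : 0 < 1 :> R).
have [k kge] := hblocks (n0 + n1 + k1)%N.
have kN : (k < N ^ k)%N by exact: ltn_expl.
have /and3P[n1k k1k n0k] : [&& n1 <= N ^ k, k1 <= k & n0 <= N ^ k.+1]%N.
  by have := nle k; clear -kge kN; lia.
have nk1 : expR 1 <= (N ^ k)%:R :> R.
  have := hk1 k k1k; rewrite mulr1 => /le_trans; apply.
  by rewrite ler_nat.
move=> hgt; exists (N ^ k.+1)%N => //.
have -> : rwalk L xi (N ^ k.+1) om = rwalk L xi (N ^ k) om + walk xi (seg L (N ^ k) (N ^
  k.+1 - N ^ k) om).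
  by rewrite -rwalkD subnKC.
have := hn1 (N ^ k)%N n1k; rewrite rwalkN => hup.
set M := (N ^ k.+1)%:R : R.
have Mk : M = N%:R * (N ^ k)%:R by rewrite /M expnS natrM.
have p0 : 0 < (N ^ k)%:R :> R by have := expR_gt0 (1 : R); lra.
have M0 : 0 < M by rewrite Mk mulr_gt0.
have ln1 : 1 <= ln (N ^ k)%:R :> R by rewrite -[leLHS]expRK ler_ln ?posrE ?expR_gt0.
have lnM1 : ln (N ^ k)%:R <= ln M by rewrite ler_ln ?posrE// ler_nat.
have lln : ln (ln (N ^ k)%:R) <= ln (ln M) by rewrite ler_ln ?posrE//; lra.
have ll0 : 0 <= ln (ln (N ^ k)%:R) :> R by exact: ln_ge0.
have q0 : 0 <= 2 * v * M * ln (ln M).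
  apply: mulr_ge0; last exact: le_trans ll0 lln.
  by apply: mulr_ge0; [apply: mulr_ge0 => //|]; exact: ltW.
have up : lil_norm v (N ^ k)%:R <= dl * lil_norm v M.
  rewrite (_ : dl * _ = Num.sqrt (dl ^+ 2 * (2 * v * M * ln (ln M)))); last first.
    by rewrite sqrtrM ?sqr_ge0// sqrtr_sqr gtr0_norm.
  rewrite ler_wsqrtr//.
  have -> : dl ^+ 2 * (2 * v * M * ln (ln M)) = 2 * v * (dl ^+ 2 * N%:R * (N ^ k)%:R * ln
    (ln M)).
    by rewrite Mk; ring.
  rewrite -[leLHS]mulrA.
  apply: ler_wpM2l; first by rewrite mulr_ge0// ltW.
  apply: ler_pM => //.
  by rewrite ler_peMl// ltW.
have low : (1 - 4 * dl) * (1 - dl) * lil_norm v M <=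
    Num.sqrt (2 * (1 - 4 * dl) * v * (N ^ k.+1 - N ^ k)%:R * ln (ln M)).
  have f0 : 0 <= (1 - 4 * dl) * (1 - dl) by apply: mulr_ge0; lra.
  rewrite (_ : _ * lil_norm v M = Num.sqrt (((1 - 4 * dl) * (1 - dl)) ^+ 2 * (2 * v * M *
    ln (ln M)))); last first.
    by rewrite sqrtrM ?sqr_ge0// sqrtr_sqr ger0_norm.
  rewrite ler_wsqrtr//.
  have mge : (1 - dl) * M <= (N ^ k.+1 - N ^ k)%:R.
    rewrite natrB// -/M; suff : (N ^ k)%:R <= dl * M by lra.
    have : 1 <= dl * N%:R.
      by apply: (le_trans hN); rewrite ler_wpM2r ?(ltW N0)// expr2; nra.
    by rewrite Mk mulrA => ?; rewrite ler_peMl// ltW.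
  apply: (@le_trans _ _ (2 * (1 - 4 * dl) * v * ((1 - dl) * M) * ln (ln M))).
    have -> : 2 * (1 - 4 * dl) * v * ((1 - dl) * M) * ln (ln M) =
      (1 - 4 * dl) * (1 - dl) * (2 * v * M * ln (ln M)) by ring.
    by rewrite ler_wpM2r// expr2 ler_piMr//; nra.
  rewrite ler_wpM2r ?(le_trans ll0)// ler_wpM2l//.
  by apply: mulr_ge0; [lra|exact: ltW].
have phi0 : 0 <= lil_norm v M := sqrtr_ge0 _.
have : (1 - dl) * ((1 - 4 * dl) * (1 - dl) * lil_norm v M) <= walk xi (seg L (N ^ k) (N ^
  k.+1 - N ^ k) om).
  by apply: le_trans (ltW hgt); rewrite ler_wpM2l//; lra.
have : 0 <= lil_norm v M * ((1 - dl) * ((1 - 4 * dl) * (1 - dl)) - (1 - 6 * dl)).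
  by apply: mulr_ge0 => //; have : 0 <= dl ^+ 2 * (1 - dl) by [apply: mulr_ge0; lra]; lra.
have : 0 <= lil_norm v M * (eps - 8 * dl) by apply: mulr_ge0 => //; lra.
lra.
Qed.

End LowerLil.

(** * The law of the label pairs *)

Section DiscreteMean.
Context {R : realType}.

Definition sum_mean (p : nat -> R) (g : nat -> R) : R := limn (series (fun i => p i * g i)).

Lemma cvg_sum_mean (p g : nat -> R) : prob_vector p -> bdd_on (fun=> True) g ->
  cvgn (series (fun i => p i * g i)).
Proof.
move=> [_ [p0 p1]] [M hM]; apply: normed_cvg.
have M0 : 0 <= M by apply: le_trans (normr_ge0 (g 0%N)) (hM _ _).
apply: (@series_le_cvg _ _ (fun i => M * p i)) => [n|n|n|].
- exact: normr_ge0.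
- by rewrite mulr_ge0.
- by rewrite /= normrM ger0_norm// mulrC ler_wpM2r// hM.
- have cp : cvgn (series p) by apply/cvg_ex; exists 1.
  exact: (@is_cvg_seriesZ _ p M cp).
Qed.

Lemma mean_sum_mean (p : nat -> R) : prob_vector p -> mean (sum_mean p).
Proof.
move=> hp; have [_ [p0 p1]] := hp; split.
- rewrite /sum_mean -[RHS](cvg_lim _ p1)//; congr (limn (series _)).
  by apply/funext => i; rewrite mulr1.
- move=> a f g bf bg; rewrite /sum_mean.
  have cf := cvg_sum_mean p f hp bf; have cg := cvg_sum_mean p g hp bg.
  have := lim_seriesD (@is_cvg_seriesZ _ _ a cf) cg; rewrite (@lim_seriesZ _ _ a cf) => <-.
  congr (limn (series _)); apply/funext => i.
  by transitivity (a * (p i * f i) + p i * g i); [ring|].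
- move=> f g bf bg fg; apply: ler_lim; try exact: cvg_sum_mean.
  by apply: nearW => n; apply: ler_sum => i _; rewrite ler_wpM2l.
Qed.

Definition pair_mean (r s : nat -> R) (g : nat * nat -> R) : R :=
  sum_mean r (fun i => sum_mean s (fun j => g (i, j))).

Lemma mean_pair_mean (r s : nat -> R) : prob_vector r -> prob_vector s -> mean (pair_mean
  r s).
Proof.
move=> hr hs; have mr := mean_sum_mean r hr; have ms := mean_sum_mean s hs.
have bj g : bdd_on (fun=> True) g -> forall i : nat, bdd_on (fun=> True) (fun j : nat =>
  g (i, j) : R).
  by move=> [M hM] i; exists M => j _; exact: hM.
have bi g : bdd_on (fun=> True) g -> bdd_on (fun=> True) (fun i => sum_mean s (fun j =>
  g (i, j))).
  by move=> [M hM]; exists M => i _; apply: (mean_norm ms) => j; exact: hM.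
split.
- rewrite /pair_mean -[RHS](mean1 _ mr); congr sum_mean.
  by apply/funext => i; exact: mean1.
- move=> a f g bf bg; rewrite /pair_mean -(mean_lin _ mr)//; try exact: bi.
  by congr sum_mean; apply/funext => i; rewrite -(mean_lin _ ms)//; exact: bj.
- move=> f g bf bg fg; apply: (mean_le _ mr); try exact: bi.
  by move=> i; apply: (mean_le _ ms); try exact: bj.
Qed.

End DiscreteMean.

Section PairLabels.
Context {d} {T : measurableType d} {R : realType} (P : probability T R).
Context (r s : nat -> R) (LR LS : nat -> T -> nat).
Hypothesis r_prob : prob_vector r.
Hypothesis s_prob : prob_vector s.
Hypothesis mLR : forall k i, measurable [set om | LR k om = i].
Hypothesis mLS : forall k i, measurable [set om | LS k om = i].
Hypothesis indep : forall (ka kb : seq nat) (va vb : nat -> nat),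
  uniq ka -> uniq kb -> all (fun k => 0 < k)%N ka -> all (fun k => 0 < k)%N kb ->
  P (cyl LR LS ka kb va vb) =
  ((\prod_(k <- ka) r (va k)) * (\prod_(k <- kb) s (vb k)))%:E.

Let L k om := (LR k om, LS k om).

Lemma measurable_split (A : set T) (X : T -> nat) :
  (forall i, measurable (A `&` [set om | X om = i])) -> measurable A.
Proof.
move=> h; have -> : A = \bigcup_i (A `&` [set om | X om = i]).
  by apply/seteqP; split => [om Aom|om [i _ []]//]; exists (X om).
exact: bigcupT_measurable.
Qed.

Lemma probability_split (A : set T) (X : T -> nat) (a : nat -> R) :
  (forall i, measurable (A `&` [set om | X om = i])) ->
  (forall i, P (A `&` [set om | X om = i]) = (a i)%:E) ->
  P A = (limn (series a))%:E.
Proof.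
move=> mA PA; have AE : A = \bigcup_i (A `&` [set om | X om = i]).
  by apply/seteqP; split => [om Aom|om [i _ []]//]; exists (X om).
have tA : trivIset setT (fun i => A `&` [set om | X om = i]).
  by move=> i j _ _ [om [[_ <-] [_ <-]]].
have fA : P A \is a fin_num by rewrite fin_num_measure//; exact: measurable_split mA.
have h : \sum_(0 <= i < n) P (A `&` [set om | X om = i]) @[n --> \oo] --> (fine (P A))%:E.
  have := @measure_semi_sigma_additive _ _ _ P _ mA tA (bigcupT_measurable _ mA).
  by rewrite -AE fineK.
rewrite -(fineK fA); congr EFin.
rewrite -(cvg_lim _ (fine_cvg h))//; congr (limn _); apply/funext => n /=.
by rewrite (eq_bigr (fun i => (a i)%:E))// sumEFin.
Qed.

Let weight (u : seq (nat * nat)) : R := \prod_(k <- u) (r k.1 * s k.2).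

Let cylinderP n u om : size u = n ->
  (seg L 0 n om = u) <-> cyl LR LS (iota 1 n) (iota 1 n)
     (fun k => (nth (0, 0)%N u k.-1).1) (fun k => (nth (0, 0)%N u k.-1).2) om.
Proof.
move=> su; split.
  move=> uE; have h k : k \in iota 1 n -> L k om = nth (0, 0)%N u k.-1.
    rewrite mem_iota => /andP[k1 k2]; rewrite -uE (nth_map 0%N) ?size_iota; last by lia.
    by rewrite nth_iota; [congr (L _ om); lia|lia].
  by split=> k /h; rewrite /L => <-.
move=> [h1 h2]; apply: (@eq_from_nth _ (0, 0)%N); rewrite size_seg// => i hi.
rewrite (nth_map 0%N) ?size_iota// nth_iota// add1n /L h1 ?h2 ?mem_iota//; try lia.
by rewrite /=; case: nth.
Qed.

(** Induction on the number m of free labels for an arbitrary fixed prefix [u]. At m = 0 the event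
    is a cylinder; otherwise splitting on both coordinates of the next label moves one pair from [g]
    into [u]. *)
Let P_prefix m n u (g : seq (nat * nat) -> bool) : size u = n ->
  let A := [set om | seg L 0 n om = u /\ g (seg L n m om)] in
  measurable A /\ P A = (weight u * Eseq (pair_mean r s) m (fun l => (g l)%:R))%:E.
Proof.
have mr := mean_sum_mean r r_prob; have ms := mean_sum_mean s s_prob.
elim: m n u g => [|m IH] n u g su A.
  rewrite /A /= /seg/=; case: (g [::]); last first.
    rewrite (_ : [set _ | _] = set0); last by apply/seteqP; split => om // [].
    by rewrite measure0 mulr0.
  rewrite (_ : [set _ | _] = cyl LR LS (iota 1 n) (iota 1 n)
     (fun k => (nth (0, 0)%N u k.-1).1) (fun k => (nth (0, 0)%N u k.-1).2)); last first.
    apply/seteqP; split => om /=; first by move=> [h _]; apply/cylinderP.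
    by move=> h; split => //; apply/cylinderP.
  split.
    apply: measurableI.
      by apply: (bigcap_measurableType (P := fun k => k \in iota 1 n)) => k _; exact: mLR.
    by apply: (bigcap_measurableType (P := fun k => k \in iota 1 n)) => k _; exact: mLS.
  rewrite indep ?iota_uniq//; try by apply/allP => k; rewrite mem_iota => /andP[].
  rewrite mulr1; congr EFin; rewrite /weight (big_nth (0, 0)%N) su -big_split/=.
  by rewrite -[1%N]addn0 iotaDl big_map /index_iota subn0.
pose X := LR n.+1; pose Y := LS n.+1.
have AE i j : A `&` [set om | X om = i] `&` [set om | Y om = j] =
    [set om | seg L 0 n.+1 om = rcons u (i, j) /\ g ((i, j) :: seg L n.+1 m om)].
  have sE om : seg L 0 n.+1 om = rcons (seg L 0 n om) (X om, Y om).
    by rewrite -addn1 seg_cat cats1.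
  apply/seteqP; split => om /=; rewrite sE.
    by move=> [[[h1 h2] h3] h4]; rewrite -h3 -h4; split => //; congr rcons.
  by move=> [/rcons_inj[h1 h2 h3] h4]; split => //; split => //; split => //;
    rewrite /seg/= /L -/X -/Y h2 h3.
have hij i j := IH n.+1 (rcons u (i, j)) (fun l => g ((i, j) :: l)).
have srcons i j : size (rcons u (i, j)) = n.+1 by rewrite size_rcons su.
have bE i : bdd_on (fun=> True) (fun j : nat => Eseq (pair_mean r s) m (fun l =>
  (g ((i, j) :: l))%:R)).
  exists 1 => j _; apply: (Eseq_norm (mean_pair_mean r s r_prob s_prob)) => l _.
  by case: (g _); rewrite ?normr1 ?normr0.
have h2 i : measurable (A `&` [set om | X om = i]) /\
    P (A `&` [set om | X om = i]) =
    (r i * (weight u * sum_mean s (fun j => Eseq (pair_mean r s) m (fun l =>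
      (g ((i, j) :: l))%:R))))%:E.
  split; first by apply: (measurable_split _ Y) => j; rewrite AE;
    have [] := hij i j (srcons i j).
  rewrite mulrA -(meanZ ms)//.
  apply: (probability_split _ Y) => j; rewrite AE; have [//] := hij i j (srcons i j).
  move=> _ ->; congr EFin; rewrite /weight -cats1 big_cat big_seq1/=; ring.
split; first by apply: (measurable_split _ X) => i; have [] := h2 i.
rewrite /= {1}/pair_mean -(meanZ mr).
  by apply: (probability_split _ X) => i; have [] := h2 i.
exists 1 => i _; apply: (mean_norm ms) => j.
apply: (Eseq_norm (mean_pair_mean r s r_prob s_prob)) => l _.
by case: (g _); rewrite ?normr1 ?normr0.
Qed.

Lemma iid_pair_labels : iid_labels P (pair_mean r s) L.
Proof.
move=> n h; have := P_prefix n 0 [::] h erefl.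
rewrite /weight big_nil mul1r (_ : [set om | _ /\ _] = [set om | h (seg L 0 n om)])//.
by apply/seteqP; split => om // [].
Qed.

End PairLabels.

(** * From the walk to the record count *)

Section Transfer.
Context {R : realType}.

Lemma limn_esup_eq1 (u : nat -> R) :
  (forall eps, 0 < eps -> \forall n \near \oo, u n <= 1 + eps) ->
  (forall eps, 0 < eps -> forall n0, exists2 n, (n0 <= n)%N & 1 - eps <= u n) ->
  limn_esup (fun n => (u n)%:E) = 1%E.
Proof.
move=> hup hlow; rewrite limn_esup_lim.
have -> : limn (esups (fun n => (u n)%:E)) = ereal_inf (range (esups (fun n => (u n)%:E))).
  by apply/cvg_lim => //; exact: cvg_esups_inf.
apply/eqP; rewrite eq_le; apply/andP; split.
  apply/lee_addgt0Pr => e e0; have [N _ hN] := hup e e0.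
  apply: (@le_trans _ _ (esups (fun n => (u n)%:E) N)).
    by apply: ereal_inf_lbound; exists N.
  apply: ge_ereal_sup => _ [n /= hn <-].
  by rewrite -EFinD lee_fin; exact: hN.
apply: le_ereal_inf_tmp => _ [N _ <-].
apply/lee_subgt0Pr => e e0; have [n hn un] := hlow e e0 N.
apply: (@le_trans _ _ (u n)%:E); first by rewrite -EFinB lee_fin.
by apply: ereal_sup_ubound; exists n.
Qed.

Lemma ae_forall_eps {d} {T : measurableType d} (P : probability T R)
    (Q : R -> T -> Prop) :
  (forall om e e', e <= e' -> Q e om -> Q e' om) ->
  (forall e, 0 < e -> {ae P, forall om, Q e om}) ->
  {ae P, forall om, forall e, 0 < e -> Q e om}.
Proof.
move=> mono h.
have : {ae P, forall om, forall k, Q k.+1%:R^-1 om}.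
  by apply: ae_foralln => k; apply: h; rewrite invr_gt0.
apply: filterS => om hom e e0.
apply: mono (hom (Num.truncn e^-1)).
rewrite -[leRHS]invrK lef_pV2 ?posrE ?invr_gt0//.
exact: ltW (truncnS_gt _).
Qed.

Lemma near_lnln_ge (A : R) : \forall n \near \oo, expR 1 <= n%:R :> R /\ A <= ln (ln n%:R).
Proof.
have := nbhs_infty_ger (expR (expR (Num.max 0 A))); apply: filterS => n hn.
have n0 : 0 < n%:R :> R by apply: lt_le_trans hn; exact: expR_gt0.
have h1 : expR (Num.max 0 A) <= ln n%:R.
  by rewrite -[leLHS]expRK ler_ln ?posrE ?expR_gt0.
have h2 : 1 <= expR (Num.max 0 A) by rewrite -expR0 ler_expR le_max lexx.
split; first by apply: le_trans hn; rewrite ler_expR.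
apply: (@le_trans _ _ (Num.max 0 A)); first by rewrite le_max lexx orbT.
by rewrite -[leLHS]expRK ler_ln ?posrE ?expR_gt0//; lra.
Qed.

Lemma lnln_double (m : R) : expR 1 <= m -> ln (ln (2 * m)) <= ln (ln m) + ln 2.
Proof.
move=> hm; have m0 : 0 < m := lt_le_trans (expR_gt0 1) hm.
have lm : 1 <= ln m by rewrite -[leLHS]expRK ler_ln ?posrE ?expR_gt0.
have l2 : ln 2 <= 1 :> R.
  by rewrite -[leRHS]expRK ler_ln ?posrE ?expR_gt0//; have := expR_ge1Dx (1 : R); lra.
have l20 : 0 < ln 2 :> R by rewrite ln_gt0//; lra.
rewrite -lnM ?posrE//; last lra.
rewrite lnM ?posrE// ler_ln ?posrE; lra.
Qed.

(** The normalizations [lil_norm (v / 2) n] and [lil_norm v (n / 2)] are asymptotically equal, since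
    doubling shifts the iterated logarithm by at most ln 2. The lower bound is taken along even n =
    2 m. *)
Lemma lil_transfer (v : R) (U D : nat -> R) : 0 < v ->
  (forall eps, 0 < eps -> \forall n \near \oo, `|D n - U n./2| <= eps * Num.sqrt n.+1%:R) ->
  (forall eps, 0 < eps -> \forall n \near \oo, U n <= (1 + eps) * lil_norm v n%:R) ->
  (forall eps, 0 < eps -> forall n0, exists2 n,
    (n0 <= n)%N & (1 - eps) * lil_norm v n%:R <= U n) ->
  limn_esup (fun n => (D n / lil_norm (v / 2) n%:R)%:E) = 1%E.
Proof.
move=> v0 hD hup hlow.
(* Here v n ln (ln n) >= 2 n >= n + 1, so an error eps sqrt (n + 1) is at most eps times the
   normalization. *)
have small n : (1 <= n)%N -> 2 / v <= ln (ln n%:R) -> Num.sqrt n.+1%:R <= lil_norm (v /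
  2) n%:R.
  move=> n1 hl; rewrite /lil_norm ler_wsqrtr//.
  rewrite ler_pdivrMr// in hl.
  have h : n.+1%:R <= 2 * n%:R :> R by rewrite -natrM ler_nat; lia.
  have : n%:R * 2 <= n%:R * (ln (ln n%:R) * v) by rewrite ler_wpM2l.
  lra.
have pos n : (1 <= n)%N -> 2 / v <= ln (ln n%:R) -> 0 < lil_norm (v / 2) n%:R.
  by move=> n1 hl; apply: lt_le_trans (small n n1 hl); rewrite sqrtr_gt0.
have n1 (n : nat) : expR 1 <= n%:R :> R -> (1 <= n)%N.
  by move=> h; rewrite -(ltr0n R); apply: lt_le_trans h; exact: expR_gt0.
apply: limn_esup_eq1 => eps e0.
- have e20 : 0 < eps / 2 by lra.
  have [N1 _ h1] := near_lnln_ge (2 / v).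
  have [N2 _ h2] := hD _ e20.
  have [N3 _ h3] := hup _ e20.
  exists (2 * (N1 + N2 + N3)).+2%N => // n /= hn.
  have /and4P[N1n N1m N2n N3m] : [&& N1 <= n, N1 <= n./2, N2 <= n & N3 <= n./2]%N.
    by clear -hn; lia.
  have half : (2 * n./2 <= n)%N by clear; lia.
  have [n1' hl] := h1 n N1n.
  have [m1 _] := h1 n./2 N1m.
  have := h2 n N2n; have := h3 n./2 N3m.
  have hs := small n (n1 _ n1') hl.
  rewrite ler_pdivrMr ?pos ?n1//.
  have : lil_norm v n./2%:R <= lil_norm (v / 2) n%:R.
    apply: (@le_trans _ _ (lil_norm (v / 2) (2 * n./2%:R))).
      rewrite /lil_norm ler_wsqrtr//.
      rewrite (_ : 2 * (v / 2) * _ * _ = 2 * v * n./2%:R * ln (ln (2 * n./2%:R)));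
        last by lra.
      have m0 : 0 < n./2%:R :> R by apply: lt_le_trans m1; exact: expR_gt0.
      have lm : 1 <= ln n./2%:R :> R by rewrite -[leLHS]expRK ler_ln ?posrE ?expR_gt0.
      have lmm : ln n./2%:R <= ln (2 * n./2%:R) :> R by rewrite ler_ln ?posrE//; lra.
      apply: ler_wpM2l; last by rewrite ler_ln ?posrE//; lra.
      by apply: mulr_ge0; [apply: mulr_ge0; [|exact: ltW]|exact: ltW].
    apply: lil_norm_le; first lra.
      by apply: le_trans m1 _; rewrite -natrM ler_nat leq_pmull.
    by rewrite -natrM ler_nat.
  move=> hh hU; rewrite ler_norml => /andP[_ hDU].
  have : (1 + eps / 2) * lil_norm v n./2%:R <= (1 + eps / 2) * lil_norm (v / 2) n%:R.
    by rewrite ler_wpM2l//; lra.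
  have : eps / 2 * Num.sqrt n.+1%:R <= eps / 2 * lil_norm (v / 2) n%:R.
    by rewrite ler_wpM2l//; lra.
  lra.
- move=> n0; pose dl := Num.min (1 / 4) (eps / 4).
  have dl0 : 0 < dl by rewrite lt_min; lra.
  have dl1 : dl <= 1 / 4 by rewrite ge_min lexx.
  have dle : dl <= eps / 4 by rewrite ge_min lexx orbT.
  (* The term ln 2 / dl lets a factor 1 - dl absorb the doubling shift ln 2. *)
  have [N1 _ h1] := near_lnln_ge (2 / v + ln 2 / dl).
  have [N2 _ h2] := hD _ dl0.
  have [m hm hU] := hlow _ dl0 (n0 + N1 + N2 + 2)%N.
  have l20 : 0 < ln 2 :> R by rewrite ln_gt0//; lra.
  have q1 : 0 < 2 / v by rewrite divr_gt0.
  have q2 : 0 < ln 2 / dl by rewrite divr_gt0.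
  have /and4P[n0m N1m N1n hN2] : [&& n0 <= 2 * m, N1 <= m, N1 <= 2 * m & N2 <= 2 * m]%N.
    by clear -hm; lia.
  exists (2 * m)%N => //.
  have [m1 ml] := h1 m N1m.
  have [n1' nl] := h1 (2 * m)%N N1n.
  have nl' : 2 / v <= ln (ln (2 * m)%:R) by lra.
  have hs := small (2 * m)%N (n1 _ n1') nl'.
  have hp := pos (2 * m)%N (n1 _ n1') nl'.
  have := h2 _ hN2.
  have -> : (2 * m)./2 = m by rewrite mul2n doubleK.
  rewrite ler_norml => /andP[hDU _].
  rewrite ler_pdivlMr//.
  have : (1 - dl) * lil_norm (v / 2) (2 * m)%:R <= lil_norm v m%:R.
    rewrite (_ : (1 - dl) * _ = Num.sqrt ((1 - dl) ^+ 2 * (2 * (v / 2) * (2 * m)%:R * ln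
      (ln (2 * m)%:R)))); last first.
      by rewrite sqrtrM ?sqr_ge0// sqrtr_sqr ger0_norm//; lra.
    rewrite /lil_norm ler_wsqrtr// natrM.
    have := lnln_double m%:R m1; rewrite natrM in nl.
    have : ln 2 <= dl * ln (ln m%:R).
      by rewrite -ler_pdivrMl// mulrC; lra.
    move: (ln (ln m%:R)) (ln (ln (2 * m%:R))) ml nl => l l' ml nl g1 g2.
    have g3 : (1 - dl) * l' <= l by nra.
    have g4 : (1 - dl) ^+ 2 * l' <= l.
      apply: le_trans g3; rewrite expr2 -mulrA ler_piMl//; last lra.
      by apply: mulr_ge0; lra.
    have : 2 * v * m%:R * ((1 - dl) ^+ 2 * l') <= 2 * v * m%:R * l.
      by rewrite ler_wpM2l// mulr_ge0// ltW// mulr_gt0.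
    lra.
  move: (lil_norm v m%:R) (lil_norm (v / 2) (2 * m)%:R) hU hp hs hDU =>
    f g hU hp hs hDU hfg.
  have : (1 - dl) * ((1 - dl) * g) <= (1 - dl) * f by rewrite ler_wpM2l//; lra.
  have : dl * Num.sqrt (2 * m).+1%:R <= dl * g by rewrite ler_wpM2l// ltW.
  have : 0 <= g * (eps - 3 * dl + dl ^+ 2) by rewrite mulr_ge0 ?(ltW hp)//;
    have := sqr_ge0 dl; lra.
  lra.
Qed.

End Transfer.

(** * Means and variances of the centred steps *)

Section StepMoments.
Context {R : realType} (r s : nat -> R).
Hypothesis r_prob : prob_vector r.
Hypothesis s_prob : prob_vector s.
Local Notation mu := (mu_rs r s).

Lemma prob_vector_itv (p : nat -> R) i : prob_vector p -> 0 <= p i <= 1.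
Proof.
move=> [_ [p0 p1]]; rewrite p0/= -(cvg_lim _ p1)//.
have nd : nondecreasing_seq (series p).
  by apply/nondecreasing_seqP => n; rewrite seriesSr lerDl.
apply: le_trans (nondecreasing_cvgn_le nd _ i.+1); last by apply/cvg_ex; exists 1.
by rewrite seriesSr lerDr /series/= sumr_ge0.
Qed.

Let bdd_pv (p : nat -> R) : prob_vector p -> bdd_on (fun=> True) p.
Proof. by move=> hp; apply: (@bdd_on_itv _ _ _ _ 0 1) => i _; exact: prob_vector_itv. Qed.

Lemma mu_rsE : mu = sum_mean r s. Proof. by []. Qed.

Lemma mu_rsC : mu = sum_mean s r.
Proof. by congr (limn (series _)); apply/funext => i; rewrite mulrC. Qed.

Lemma mu_itv : 0 <= mu <= 1.
Proof.
have ms := mean_sum_mean r r_prob; rewrite mu_rsE.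
rewrite -{1}(mean_cst ms 0) -[in X in _ && X](mean_cst ms 1).
by apply/andP; split; apply: (mean_le _ ms); try exact: bdd_on_cst; try exact: bdd_pv;
  move=> i; have /andP[] := prob_vector_itv s i s_prob.
Qed.

Definition stepR (k : nat * nat) : R := s k.1 - mu.
Definition stepS (k : nat * nat) : R := r k.2 - mu.
Definition step (k : nat * nat) : R := stepS k - stepR k.

Lemma stepR_norm k : `|stepR k| <= 1.
Proof.
have /andP[m0 m1] := mu_itv; have /andP[s0 s1] := prob_vector_itv s k.1 s_prob.
by rewrite ler_norml /stepR; lra.
Qed.

Lemma stepS_norm k : `|stepS k| <= 1.
Proof.
have /andP[m0 m1] := mu_itv; have /andP[s0 s1] := prob_vector_itv r k.2 r_prob.
by rewrite ler_norml /stepS; lra.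
Qed.

(** The drift cancels, leaving a difference of two numbers in [0, 1]; hence 1 and not 2, as the walk
    estimates require. *)
Lemma step_norm k : `|step k| <= 1.
Proof.
have /andP[r0 r1] := prob_vector_itv r k.2 r_prob.
have /andP[s0 s1] := prob_vector_itv s k.1 s_prob.
by rewrite ler_norml /step /stepR /stepS; lra.
Qed.

Let center (p q : nat -> R) : prob_vector p -> prob_vector q ->
  sum_mean p (fun i => q i - sum_mean p q) = 0.
Proof.
move=> hp hq; have mp := mean_sum_mean p hp.
by rewrite (meanD mp) ?(mean_cst mp) ?subrr//; [exact: bdd_pv|exact: bdd_on_cst].
Qed.

Lemma mean_stepR : pair_mean r s stepR = 0.
Proof.
rewrite /pair_mean -[RHS](center r s r_prob s_prob) -mu_rsE; congr sum_mean.
by apply/funext => i; rewrite /stepR/= (mean_cst (mean_sum_mean s s_prob)).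
Qed.

Lemma mean_stepS : pair_mean r s stepS = 0.
Proof.
rewrite /pair_mean -[RHS](mean_cst (mean_sum_mean r r_prob)); congr sum_mean.
by apply/funext => i; rewrite /stepS mu_rsC center.
Qed.

Lemma mean_step : pair_mean r s step = 0.
Proof.
have mp := mean_pair_mean r s r_prob s_prob.
have -> : step = (fun k => -1 * stepR k + stepS k).
  by apply/funext => k; rewrite mulN1r addrC.
rewrite (mean_lin _ mp) ?mean_stepR ?mean_stepS ?mulr0 ?addr0//.
  by exists 1 => k _; exact: stepR_norm.
by exists 1 => k _; exact: stepS_norm.
Qed.

(** The cross term vanishes already in the inner sum, where r j - mu has mean 0 under s. *)
Lemma step_var_step : step_var (pair_mean r s) step = var_lab r s mu + var_lab s r mu.
Proof.
have mr := mean_sum_mean r r_prob; have ms := mean_sum_mean s s_prob.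
have bR : bdd_on (fun=> True) (fun i : nat => (s i - mu) ^+ 2).
  by apply: bdd_onM; exists 1 => i _; exact: (stepR_norm (i, 0%N)).
have bS : bdd_on (fun=> True) (fun j : nat => (r j - mu) ^+ 2).
  by apply: bdd_onM; exists 1 => j _; exact: (stepS_norm (0%N, j)).
have bS1 : bdd_on (fun=> True) (fun j : nat => r j - mu).
  by exists 1 => j _; exact: (stepS_norm (0%N, j)).
have c0 : sum_mean s (fun j => r j - mu) = 0 by rewrite mu_rsC center.
rewrite /step_var /pair_mean.
have -> : (fun i => sum_mean s (fun j => step (i, j) ^+ 2)) =
    (fun i => (s i - mu) ^+ 2 + var_lab s r mu).
  apply/funext => i.
  have -> : (fun j => step (i, j) ^+ 2) =
      (fun j => - 2 * (s i - mu) * (r j - mu) + ((r j - mu) ^+ 2 + (s i - mu) ^+ 2)).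
    by apply/funext => j; rewrite /step /stepS /stepR/=; ring.
  rewrite (mean_lin _ ms)//; last by apply: bdd_onD => //; exact: bdd_on_cst.
  by rewrite c0 mulr0 add0r (meanD ms) ?(mean_cst ms) 1?addrC//; exact: bdd_on_cst.
by rewrite (meanD mr) ?(mean_cst mr)//; exact: bdd_on_cst.
Qed.

Lemma var_lab_ge0 (p q : nat -> R) (m : R) : (forall i, 0 <= p i) -> 0 <= var_lab p q m.
Proof.
move=> p0; rewrite /var_lab.
have nd : nondecreasing_seq (series (fun i => p i * (q i - m) ^+ 2)).
  by apply/nondecreasing_seqP => n; rewrite seriesSr lerDl mulr_ge0// sqr_ge0.
(* In the divergent case [limn] is the default point 0. *)
have [c|/dvgP->//] := pselect (cvgn (series (fun i => p i * (q i - m) ^+ 2))).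
apply: le_trans (nondecreasing_cvgn_le nd c 0%N).
by rewrite /series/= big_geq.
Qed.

End StepMoments.

(** * The greedy balance and the record count *)

Section Greedy.
Context {d} {T : measurableType d} {R : realType}.
Context (r s : nat -> R) (LR LS : nat -> T -> nat) (C : nat -> T -> bool).

Lemma Rcnt_le n om : (Rcnt C n om <= n)%N.
Proof.
rewrite /Rcnt; apply: leq_trans (_ : (\sum_(1 <= j < n.+1) 1 <= _)%N).
  by apply: leq_sum => j _; case: (C j om).
by rewrite sum_nat_const_nat muln1 subn1.
Qed.

Lemma RcntS n om : Rcnt C n.+1 om = (Rcnt C n om + C n.+1 om)%N.
Proof. by rewrite /Rcnt big_nat_recr. Qed.

Lemma ScntS n om : Scnt C n.+1 om = (Scnt C n om + ~~ C n.+1 om)%N.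
Proof.
rewrite /Scnt RcntS; have := Rcnt_le n om.
by case: (C n.+1 om) => /=; lia.
Qed.

Lemma GamS (L : nat -> T -> nat) (w : nat -> R) n om :
  Gam L w n.+1 om = Gam L w n om + w (L n.+1 om).
Proof. by rewrite /Gam big_nat_recr. Qed.

(** A step in [0, 1] is added to the smaller total, or to either one at a tie, so the difference
    cannot leave [-1, 1]. *)
Lemma greedy_balance om :
  (forall i, 0 <= r i <= 1) -> (forall i, 0 <= s i <= 1) ->
  (forall n, (1 <= n)%N ->
     Gam LS r (Scnt C n om) om > Gam LR s (Rcnt C n om) om -> C n.+1 om = true) ->
  (forall n, (1 <= n)%N ->
     Gam LS r (Scnt C n om) om < Gam LR s (Rcnt C n om) om -> C n.+1 om = false) ->
  forall n, `|Gam LS r (Scnt C n om) om - Gam LR s (Rcnt C n om) om| <= 1.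
Proof.
move=> r01 s01 gt lt; elim=> [|n IH].
  by rewrite /Scnt /Rcnt big_geq// /Gam !big_geq// subrr normr0.
rewrite RcntS ScntS; set X := Gam LS r _ om in IH *; set Y := Gam LR s _ om in IH *.
(* The greedy rule starts at n = 1; at n = 0 both totals vanish, so either choice satisfies the
   claim. *)
have h : (C n.+1 om -> Y <= X) /\ (~~ C n.+1 om -> X <= Y).
  case: n @X @Y {IH} => [|n] X Y.
    by rewrite /X /Y /Scnt /Rcnt big_geq// /Gam !big_geq.
  split=> hC; rewrite leNgt; apply/negP => hXY.
    by have := lt n.+1 isT hXY; rewrite hC.
  by have := gt n.+1 isT hXY; move/negbTE: hC => ->.
move: h IH; rewrite !ler_norml => -[h1 h2] /andP[i1 i2].
case: (C n.+1 om) h1 h2 => /= h1 h2.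
- rewrite addn0 addn1 GamS -/X -/Y; have /andP[s0 s1] := s01 (LR (Rcnt C n om).+1 om).
  by have := h1 isT; lra.
- rewrite addn0 addn1 GamS -/X -/Y; have /andP[s0 s1] := r01 (LS (Scnt C n om).+1 om).
  by have := h2 isT; lra.
Qed.

End Greedy.

(* [13 = 6 + 6 + 1]: the rough bounds on [A] and [B], and the greedy imbalance. *)
Lemma greedy_count_approx {R : realType} (mu : R) (A B : nat -> R) (cnt : nat -> nat) :
  0 < mu -> (forall n, (cnt n <= n)%N) ->
  (forall n, `|((n - cnt n)%:R * mu + B (n - cnt n)%N) - ((cnt n)%:R * mu + A (cnt n))|
    <= 1) ->
  (\forall n \near \oo, forall m, (m <= n)%N -> `|A m| < 6 * Num.sqrt (n.+1%:R * ln
    n.+1%:R)) ->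
  (\forall n \near \oo, forall m, (m <= n)%N -> `|B m| < 6 * Num.sqrt (n.+1%:R * ln
    n.+1%:R)) ->
  (forall eps, 0 < eps -> \forall n \near \oo, forall i h, (i <= n)%N ->
     h%:R <= (13 / mu + 1) * Num.sqrt (n.+1%:R * ln n.+1%:R) ->
     `|A (i + h)%N - A i| < eps * Num.sqrt n.+1%:R) ->
  (forall eps, 0 < eps -> \forall n \near \oo, forall i h, (i <= n)%N ->
     h%:R <= (13 / mu + 1) * Num.sqrt (n.+1%:R * ln n.+1%:R) ->
     `|B (i + h)%N - B i| < eps * Num.sqrt n.+1%:R) ->
  forall eps, 0 < eps -> \forall n \near \oo,
    `|2 * mu * ((cnt n)%:R - n%:R / 2) - (B n./2 - A n./2)| <= eps * Num.sqrt n.+1%:R.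
Proof.
move=> mu0 cnt_le bal hA hB oA oB eps e0.
have e30 : 0 < eps / 3 by lra.
have [N1 _ h1] := hA; have [N2 _ h2] := hB.
have [N3 _ h3] := oA _ e30; have [N4 _ h4] := oB _ e30.
(* expR 1 gives ln (n + 1) >= 1; (3 / eps)^2 makes the imbalance 1 at most eps / 3 times sqrt (n +
   1). *)
have [N5 _ h5] := nbhs_infty_ger (expR 1 + (3 / eps) ^+ 2).
exists (N1 + N2 + N3 + N4 + N5)%N => // n /= hn.
have /h1{}h1 : (N1 <= n)%N by lia.
have /h2{}h2 : (N2 <= n)%N by lia.
have /h3{}h3 : (N3 <= n)%N by lia.
have /h4{}h4 : (N4 <= n)%N by lia.
have /h5{}h5 : (N5 <= n)%N by lia.
have half_le : (n./2 <= n)%N by lia.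
have nh : n%:R - 1 <= 2 * n./2%:R :> R /\ 2 * n./2%:R <= n%:R :> R.
  rewrite -natrM lerBlDr natr1 !ler_nat; lia.
have {}hn : (cnt n <= n)%N := cnt_le n.
set q := Num.sqrt (n.+1%:R * ln n.+1%:R) in h1 h2 h3 h4.
have nS : n.+1%:R = n%:R + 1 :> R by rewrite -natr1.
have e1 := expR_gt0 (1 : R).
have sq0 : 0 <= (3 / eps) ^+ 2 := sqr_ge0 _.
have n0 : 0 < n.+1%:R :> R by rewrite ltr0n.
have en : expR 1 <= n.+1%:R :> R by rewrite nS; lra.
have ln1 : 1 <= ln n.+1%:R :> R by rewrite -[leLHS]expRK ler_ln ?posrE ?expR_gt0.
have e2 := expR_ge1Dx (1 : R).
have q1 : 1 <= q.
  rewrite -[leLHS]sqrtr1 ler_wsqrtr//.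
  have n1 : 1 <= n.+1%:R :> R by lra.
  by apply: (le_trans n1); rewrite ler_peMr// ltW.
have s1 : 1 <= eps / 3 * Num.sqrt n.+1%:R.
  rewrite -ler_pdivrMl// mulr1 invf_div -[leLHS]ger0_norm ?divr_ge0 ?(ltW e0)//.
  by rewrite -sqrtr_sqr ler_wsqrtr// nS; lra.
have subE : (n - cnt n)%:R = n%:R - (cnt n)%:R :> R by rewrite natrB.
have {bal} := bal n; rewrite subE.
have hAR := h1 _ hn; have hBS := h2 _ (leq_subr (cnt n) n).
have imu : 13 / mu * mu = 13 by rewrite divfK// lt0r_neq0.
move=> bal.
(* Moving an index to n/2 costs eps / 3. The extra 1 in 13 / mu + 1 pays for the rounding in [n./2],
   as q >= 1. *)
have close (a : nat) : (a <= n)%N -> `|(2 * a%:R - n%:R) * mu| <= 13 * q ->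
    forall F : nat -> R, (forall i h, (i <= n)%N -> h%:R <= (13 / mu + 1) * q ->
      `|F (i + h)%N - F i| < eps / 3 * Num.sqrt n.+1%:R) ->
    `|F a - F n./2| <= eps / 3 * Num.sqrt n.+1%:R.
  move=> an ha F hF.
  have ha2 : `|2 * a%:R - n%:R| <= 13 / mu * q.
    by rewrite -(ler_pM2r mu0) -{1}(gtr0_norm mu0) -normrM mulrAC imu.
  move: ha2; rewrite ler_norml => /andP[c1 c2].
  case: (leqP n./2 a) => ha3.
    have := hF n./2 (a - n./2)%N half_le; rewrite subnKC// => hh; apply/ltW/hh.
    by rewrite natrB// mulrDl mul1r; lra.
  have := hF a (n./2 - a)%N an; rewrite subnKC 1?ltnW// distrC => hh; apply/ltW/hh.
  by rewrite natrB 1?ltnW// mulrDl mul1r; lra.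
move: hAR hBS bal; rewrite !ltr_norml !ler_norml => /andP[a1 a2] /andP[b1 b2] /andP[c1 c2].
have hR : `|(2 * (cnt n)%:R - n%:R) * mu| <= 13 * q by rewrite ler_norml; lra.
have hS : `|(2 * (n - cnt n)%:R - n%:R) * mu| <= 13 * q by rewrite subE ler_norml; lra.
have := close _ hn hR A h3; have := close _ (leq_subr _ _) hS B h4.
by rewrite !ler_norml => /andP[f1 f2] /andP[g1 g2]; apply/andP; split; lra.
Qed.

Theorem theorem3p3 (d : measure_display) (T : measurableType d) (R : realType)
  (P : probability T R)
  (r s : nat -> R) (LR LS : nat -> T -> nat)
  (F0 : set (set T)) (C : nat -> T -> bool) :
  prob_vector r -> prob_vector s ->
  0 < mu_rs r s ->
  (* standing assumption sigma_R + sigma_S > 0 *)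
  0 < Num.sqrt (var_lab r s (mu_rs r s)) + Num.sqrt (var_lab s r (mu_rs r s)) ->
  (* labels are random variables *)
  (forall k i, measurable [set om | LR k om = i]) ->
  (forall k i, measurable [set om | LS k om = i]) ->
  (* {L_R(n)}_{n>=1}, {L_S(n)}_{n>=1}: independent i.i.d. sequences with
     laws (r_i), (s_i): product rule over every finite subfamily *)
  (forall (ka kb : seq nat) (va vb : nat -> nat),
      uniq ka -> uniq kb -> all (fun k => 0 < k)%N ka -> all (fun k => 0 < k)%N kb ->
      P (cyl LR LS ka kb va vb) =
      ((\prod_(k <- ka) r (va k)) * (\prod_(k <- kb) s (vb k)))%:E) ->
  (* F_0 (randomization) is a family of events independent of the labels *)
  F0 `<=` measurable ->
  (forall A (ka kb : seq nat) (va vb : nat -> nat), F0 A ->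
      all (fun k => 0 < k)%N ka -> all (fun k => 0 < k)%N kb ->
      P (A `&` cyl LR LS ka kb va vb) = (P A * P (cyl LR LS ka kb va vb))%E) ->
  (* reading policy: C(n+1) is F_n-measurable *)
  (forall n (b : bool), in_Fn F0 LR LS C n [set om | C n.+1 om = b]) ->
  (* greedy policy *)
  (forall n om, (1 <= n)%N ->
     Gam LS r (Scnt C n om) om > Gam LR s (Rcnt C n om) om -> C n.+1 om = true) ->
  (forall n om, (1 <= n)%N ->
     Gam LS r (Scnt C n om) om < Gam LR s (Rcnt C n om) om -> C n.+1 om = false) ->
  let sig2 := (var_lab r s (mu_rs r s) + var_lab s r (mu_rs r s))
              / (8 * (mu_rs r s) ^+ 2) in
  let Z := fun om n => (((Rcnt C n om)%:R - n%:R / 2)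
                        / Num.sqrt (2 * sig2 * n%:R * ln (ln n%:R)))%:E in
  {ae P, forall om, limn_esup (Z om) = 1%E /\ limn_einf (Z om) = (-1)%E}.
Proof.
move=> hr hs mu0 hsig mLR mLS indep _ _ _ gt lt sig2 Z.
set mu := mu_rs r s in mu0 *.
set v := var_lab r s mu + var_lab s r mu.
have v0 : 0 < v.
  have [_ [r0 _]] := hr; have [_ [s0 _]] := hs.
  have vr := var_lab_ge0 r s mu r0; have vs := var_lab_ge0 s r mu s0.
  rewrite lt_neqAle addr_ge0// andbT eq_sym; apply/negP => /eqP v0.
  have vr0 : var_lab r s mu = 0 by rewrite /v in v0; lra.
  have vs0 : var_lab s r mu = 0 by rewrite /v in v0; lra.
  by move: hsig; rewrite -/mu vr0 vs0 sqrtr0 addr0 ltxx.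
pose L k om := (LR k om, LS k om).
have HE := mean_pair_mean r s hr hs.
have iidL : iid_labels P (pair_mean r s) L by exact: iid_pair_labels.
have nR := stepR_norm r s hr hs; have mR := mean_stepR r s hr hs.
have nS := stepS_norm r s hr hs; have mS := mean_stepS r s hr hs.
have nW := step_norm r s hr hs; have mW := mean_step r s hr hs.
have vE : step_var (pair_mean r s) (step r s) = v by exact: step_var_step.
have C0 : 0 < 13 / mu + 1 by rewrite addr_gt0// divr_gt0.
have upP : {ae P, forall om eps, 0 < eps ->
    \forall n \near \oo, rwalk L (step r s) n om <= (1 + eps) * lil_norm v n%:R}.
  apply: ae_forall_eps => [om e e' ee'|e e0].
    by apply: filterS => n /le_trans; apply; rewrite ler_wpM2r ?sqrtr_ge0// lerD2l.
  by rewrite -vE; apply: lil_upper iidL _ _ _ _ _ _ => //; rewrite vE.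
have upN : {ae P, forall om eps, 0 < eps ->
    \forall n \near \oo, rwalk L (fun k => - step r s k) n om <= (1 + eps) * lil_norm v
      n%:R}.
  apply: ae_forall_eps => [om e e' ee'|e e0].
    by apply: filterS => n /le_trans; apply; rewrite ler_wpM2r ?sqrtr_ge0// lerD2l.
  rewrite -vE -step_varN; apply: (lil_upper HE iidL _ (step_normN _ nW) (mean_stepN HE _
    nW mW)) => //.
  by rewrite step_varN vE.
have lowP : {ae P, forall om eps, 0 < eps -> forall n0, exists2 n, (n0 <= n)%N &
    (1 - eps) * lil_norm v n%:R <= rwalk L (step r s) n om}.
  apply: ae_forall_eps => [om e e' ee' h n0|e e0].
    have [n nn hn] := h n0; exists n => //; apply: le_trans hn.
    by rewrite ler_wpM2r ?sqrtr_ge0// lerD2l lerN2.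
  by rewrite -vE; apply: lil_lower iidL _ _ _ _ _ _ => //; rewrite vE.
have lowN : {ae P, forall om eps, 0 < eps -> forall n0, exists2 n, (n0 <= n)%N &
    (1 - eps) * lil_norm v n%:R <= rwalk L (fun k => - step r s k) n om}.
  apply: ae_forall_eps => [om e e' ee' h n0|e e0].
    have [n nn hn] := h n0; exists n => //; apply: le_trans hn.
    by rewrite ler_wpM2r ?sqrtr_ge0// lerD2l lerN2.
  rewrite -vE -step_varN; apply: (lil_lower HE iidL _ (step_normN _ nW) (mean_stepN HE _
    nW mW)) => //.
  by rewrite step_varN vE.
have rough xi := walk_rough_bound HE iidL xi.
have osc (xi : nat * nat -> R) : (forall k, `|xi k| <= 1) -> pair_mean r s xi = 0 ->
    {ae P, forall om eps, 0 < eps -> \forall n \near \oo, forall i h, (i <= n)%N ->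
     h%:R <= (13 / mu + 1) * Num.sqrt (n.+1%:R * ln n.+1%:R) ->
     `|rwalk L xi (i + h) om - rwalk L xi i om| < eps * Num.sqrt n.+1%:R}.
  move=> n1 m0; apply: ae_forall_eps => [om e e' ee'|e e0].
    apply: filterS => n hn i h hi hh; apply: lt_le_trans (hn i h hi hh) _.
    by rewrite ler_wpM2r ?sqrtr_ge0.
  exact: (walk_oscillation HE iidL).
apply: filterS (filterI (rough _ nR mR) (filterI (rough _ nS mS) (filterI (osc _ nR mR)
  (filterI (osc _ nS mS) (filterI upP (filterI upN (filterI lowP lowN))))))).
move=> om [hA [hB [oA [oB [uP [uN [lP lN]]]]]]].
have WE (xi : nat * nat -> R) m : rwalk L xi m om = \sum_(1 <= j < m.+1) xi (L j om).
  by rewrite /rwalk /walk big_map /index_iota subn1.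
have WR m : Gam LR s m om = m%:R * mu + rwalk L (stepR r s) m om.
  by rewrite WE /stepR sumrB sumr_const_nat subn1 [RHS]addrC -[_ *+ _]mulr_natl subrK.
have WS m : Gam LS r m om = m%:R * mu + rwalk L (stepS r s) m om.
  by rewrite WE /stepS sumrB sumr_const_nat subn1 [RHS]addrC -[_ *+ _]mulr_natl subrK.
have Wstep m : rwalk L (step r s) m om = rwalk L (stepS r s) m om - rwalk L (stepR r s) m
  om.
  by rewrite !WE -sumrB.
have bal := greedy_balance r s LR LS C om (fun i => prob_vector_itv r i hr)
  (fun i => prob_vector_itv s i hs) (gt ^~ om) (lt ^~ om).
pose D n := 2 * mu * ((Rcnt C n om)%:R - n%:R / 2).
have approx : forall eps, 0 < eps -> \forall n \near \oo,
    `|D n - rwalk L (step r s) n./2 om| <= eps * Num.sqrt n.+1%:R.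
  move=> eps e0.
  have := greedy_count_approx mu (rwalk L (stepR r s) ^~ om) (rwalk L (stepS r s) ^~ om)
    (Rcnt C ^~ om) mu0 (Rcnt_le C ^~ om) _ hA hB oA oB eps e0.
  move=> h; apply: filterS (h _) => n; first by rewrite Wstep.
  by rewrite -WR -WS; exact: bal.
(* The two normalizations agree because (2 mu)^2 [sig2] = v / 2. *)
have ZE n : Z om n = (D n / lil_norm (v / 2) n%:R)%:E.
  have mu2 : 0 < 2 * mu by rewrite mulr_gt0.
  rewrite /Z /D /lil_norm; congr EFin.
  have -> : Num.sqrt (2 * (v / 2) * n%:R * ln (ln n%:R)) =
      2 * mu * Num.sqrt (2 * sig2 * n%:R * ln (ln n%:R)).
    rewrite -[X in X * Num.sqrt _](gtr0_norm mu2) -sqrtr_sqr -sqrtrM ?sqr_ge0//.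
    congr Num.sqrt; rewrite /sig2 -/mu -/v; field.
    by rewrite lt0r_neq0.
  by rewrite invfM mulrACA divff ?mul1r// lt0r_neq0.
split.
  have -> : Z om = (fun n => (D n / lil_norm (v / 2) n%:R)%:E) by apply/funext.
  exact: (lil_transfer v (rwalk L (step r s) ^~ om) D v0 approx uP lP).
(* The lower limit is minus the upper limit of the negated sequence, which follows the walk with
   negated steps. *)
rewrite /limn_einf; congr (- _)%E.
have -> : (\- Z om)%E = (fun n => (- D n / lil_norm (v / 2) n%:R)%:E).
  by apply/funext => n; rewrite ZE mulNr.
apply: (lil_transfer v (rwalk L (fun k => - step r s k) ^~ om) (fun n =>
  - D n) v0 _ uN lN) => eps e0.
by apply: filterS (approx eps e0) => n; rewrite rwalkN -opprD normrN.
Qed.
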